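(* Assume, in addition to the standing assumptions of the context, that: (1) the linear operator $\mathcal{D}_0$ is bounded from $\bar H^{1/2}$ into $\bar H$ and there exist $c_0>0$ and $\bar\alpha\ge0$ such that $$((\mathcal{D}_0+\bar\alpha\mathcal{K})W,W)\ge c_0\|W\|^2,\quad W\in\bar H^{1/2};$$ (2) there exist $\eta<1$ and $\delta,C>0$ such that $$\delta\,\bar\Pi_0(U)-(\mathcal{B}(U),U)\le\eta\|\mathcal{A}^{1/2}U\|^2+C,\quad U\in\bar H^{1/2},$$ where $\bar\Pi_0(U)=\Pi_{01}(u)+\Pi_{02}(v)$ for $U=(u;v)$. Then for every $\alpha\ge\bar\alpha$ and $\varkappa\ge0$ the dynamical system $(\mathcal{H},S_t)$ generated by $$U_{tt}+\mathcal{A}U+(\mathcal{D}_0+\alpha\mathcal{K})U_t+\varkappa\mathcal{K}U+\mathcal{B}(U)=0,\quad U(0)=U_0,\ U_t(0)=U_1,$$ is dissipative with an absorbing ball of size independent of $(\alpha;\varkappa)\in\Lambda:=\{\alpha\ge\bar\alpha,\ \varkappa\ge0\}$. More precisely, there exists $R$ independent of $(\alpha;\varkappa)\in\Lambda$ such that the set $$\mathfrak{B}=\left\{(U_0;U_1)\in\mathcal{H}:\ \|U_1\|^2+\|\mathcal{A}^{1/2}U_0\|^2+\varkappa\|\mathcal{K}^{1/2}U_0\|^2\le R^2\right\}$$ is absorbing.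
   Context: Spaces. $H$ is a separable Hilbert space with norm $\|\cdot\|$ and inner product $(\cdot,\cdot)$; $A$ is a self-adjoint positive operator with dense domain in $H$ and compact resolvent. For $s>0$, $H^s$ is the domain of $A^s$ with norm $\|\cdot\|_s=\|A^s\cdot\|$, and $H^{-s}$ is the completion of $H$ in the norm $\|A^{-s}\cdot\|$; $H^0=H$; $(\cdot,\cdot)$ also denotes the duality between $H^s$ and $H^{-s}$. $\bar H^s=H^s\times H^s$, $\bar H=H\times H$ (with the product norms, inner products and dualities, denoted in the same way). Standing assumptions. $\nu_1,\nu_2>0$. $U=(u;v)$, $\mathcal{A}U=(\nu_1Au;\nu_2Av)$, so $\|\mathcal{A}^{1/2}U\|^2=\nu_1\|A^{1/2}u\|^2+\nu_2\|A^{1/2}v\|^2$; $\mathcal{B}(U)=(B_1(u);B_2(v))$. The matrix operator $\mathcal{K}=(K_{ij})_{i,j=1,2}$ with linear $K_{ij}:H^{1/2}\to H$ generates a symmetric nonnegative bilinear form on $\bar H^{1/2}$; $\|\mathcal{K}^{1/2}U\|^2:=(\mathcal{K}U,U)$. For the parameters $(\alpha;\varkappa)\in\Lambda$ under consideration the damping operator $\mathcal{D}=\mathcal{D}_0+\alpha\mathcal{K}$ generates a symmetric nonnegative bilinear form on $\bar H^{1/2}$. The operators $B_i:H^{1/2}\to H$, $i=1,2$, are locally Lipschitz: for every $\varrho>0$ there is $L(\varrho)$ with $\|B_i(u)-B_i(v)\|\le L(\varrho)\|u-v\|_{1/2}$ whenever $\|u\|_{1/2},\|v\|_{1/2}\le\varrho$.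 They are potential: $B_i(u)=\Pi_i'(u)$ for a Fréchet differentiable functional $\Pi_i:H^{1/2}\to\mathbb{R}$ (i.e. $\|w\|_{1/2}^{-1}[\Pi_i(u+w)-\Pi_i(u)-(B_i(u),w)]\to0$ as $\|w\|_{1/2}\to0$), and $\Pi_i=\Pi_{0i}+\Pi_{1i}$, where $\Pi_{0i}\ge0$ is locally bounded on $H^{1/2}$ and for every $\eta>0$ there is $C_\eta$ with $|\Pi_{1i}(u)|\le\eta[\|A^{1/2}u\|^2+\Pi_{0i}(u)]+C_\eta$ for all $u\in H^{1/2}$. Solutions. A function $U\in C([0,T];\bar H^{1/2})\cap C^1([0,T];\bar H)$ with $U(0)=U_0$, $U_t(0)=U_1$ is a strong solution on $[0,T]$ if for any $0<a<b<T$ both $U:[a,b]\to\bar H^{1/2}$ and $U_t:[a,b]\to\bar H$ are continuous with derivative in $L_1(a,b;\bar H^{1/2})$, resp. $L_1(a,b;\bar H)$, $\mathcal{A}U(t)+\mathcal{D}U_t(t)\in\bar H$ for a.a. $t$ (with $\mathcal D=\mathcal D_0+\alpha\mathcal K$), and the equation holds in $\bar H$ for a.a. $t$. It is a generalized solution if there are strong solutions $U_n$ (with initial data $(U_{0n},U_{1n})$) such that $\max_{[0,T]}\{\|\partial_tU-\partial_tU_n\|+\|\mathcal{A}^{1/2}(U-U_n)\|\}\to0$. Under the standing assumptions, for every $(U_0;U_1)\in\mathcal{H}:=\bar H^{1/2}\times\bar H$ there is a unique generalized solution on every $[0,T]$, and $S_t(U_0;U_1)=(U(t);U_t(t))$ defines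 the dynamical system $(\mathcal{H},S_t)$ (depending on $(\alpha;\varkappa)$). A closed set $B\subset X$ is absorbing for a dynamical system $(X,S_t)$ if for any bounded $D\subset X$ there is $t_0(D)$ with $S_tD\subset B$ for all $t\ge t_0(D)$; the system is dissipative if it has a bounded absorbing set. *)

(* Defs.v *)
From HB Require Import structures.
From mathcomp Require Export all_boot all_order all_algebra sesquilinear.
From mathcomp Require Export all_classical all_reals all_analysis.
Set Implicit Arguments.
Unset Strict Implicit.
Unset Printing Implicit Defensive.
Export Order.TTheory GRing.Theory Num.Theory numFieldNormedType.Exports.
#[global] Open Scope classical_set_scope.
#[global] Open Scope ring_scope.

(* A normed space X contained, as a vector space, in V.  The spaces H, H^{1/2},
   their squares and the phase space are all of this form, which lets an element
   of H^{1/2} be used as an element of H without any coercion. *)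
Record nspace (R : realType) (V : lmodType R) :=
  NSpace { carrier : set V ; nrm : V -> R }.

Section FunctionSpaces.
Context {R : realType} {V : lmodType R}.
Implicit Types (X : nspace V) (I : set R) (f g : R -> V).

Definition cont_on X I f := forall t, I t ->
  carrier X (f t) /\
  nrm X (f s - f t) @[s --> within I (nbhs t)] --> (0 : R).

(* y is the derivative of f at t in the norm of X, along increments that stay
   in I (so it is one-sided at an end point of I). *)
Definition deriv_in X I f t (y : V) :=
  nrm X ((s - t)^-1 *: (f s - f t) - y) @[s --> within I (t^')] --> (0 : R).

Definition abs_cont_on X (a b : R) f :=
  forall e : R, 0 < e -> exists2 d : R, 0 < d &
    forall (n : nat) (l r : 'I_n -> R),
      (forall i, a <= l i /\ l i <= r i /\ r i <= b) ->
      (forall i j, i != j -> r i <= l j \/ r j <= l i) ->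
      \sum_(i < n) (r i - l i) < d ->
      \sum_(i < n) nrm X (f (r i) - f (l i)) < e.

(* f : [a, b] -> X is (absolutely) continuous with derivative in L_1(a, b; X).
   The strong measurability of g needs no clause: almost everywhere, g is a
   limit of difference quotients of a continuous function. *)
Definition W11 X (a b : R) f :=
  [/\ cont_on X `[a, b] f,
      abs_cont_on X a b f &
      exists g : R -> V,
        [/\ forall t, carrier X (g t),
            {ae lebesgue_measure,
               forall t, t \in `]a, b[ -> deriv_in X `[a, b] f t (g t)} &
            lebesgue_measure.-integrable `[a, b] (EFin \o (nrm X \o g))]].

End FunctionSpaces.

Section DynamicalSystems.
Context {R : realType} {V : lmodType R}.
Implicit Types (X : nspace V) (B D : set V) (S : R -> V -> V).

Definition closed_in X B := B `<=` carrier X /\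
  forall x, carrier X x ->
    (forall e : R, 0 < e -> exists2 y, B y & nrm X (x - y) < e) -> B x.

Definition bounded_in X B := B `<=` carrier X /\
  exists M : R, forall x, B x -> nrm X x <= M.

Definition absorbing X S B := closed_in X B /\
  forall D, bounded_in X D ->
    exists2 t0 : R, 0 <= t0 & forall t, t0 <= t -> S t @` D `<=` B.

Definition dissipative X S := exists2 B, bounded_in X B & absorbing X S B.

Definition ball_of X (r : R) := [set x | carrier X x /\ nrm X x <= r].

End DynamicalSystems.

Section Operators.
Context {R : realType}.

Definition separable (T : topologicalType) :=
  exists2 D : set T, countable D & dense D.

Definition lin_subspace (V : lmodType R) (D : set V) :=
  D 0 /\ forall (a : R) x y, D x -> D y -> D (a *: x + y).

Definition linear_on (V W : lmodType R) (D : set V) (f : V -> W) :=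
  forall (a : R) x y, D x -> D y -> f (a *: x + y) = a *: f x + f y.

(* A possibly unbounded operator; its values outside pdom are meaningless. *)
Record pop (H : Type) := POp { pdom : set H ; papp :> H -> H }.

Context {H : completeNormedModType R} (ip : {dot H for idfun}).
Implicit Types A S : pop H.

(* The last clause says that the domain of the adjoint is not larger. *)
Definition self_adjoint A :=
  [/\ lin_subspace (pdom A), linear_on (pdom A) A, dense (pdom A),
      forall x y, pdom A x -> pdom A y -> ip (A x) y = ip x (A y) &
      forall y z, (forall x, pdom A x -> ip (A x) y = ip x z) -> pdom A y].

Definition positive_op A := forall x, pdom A x -> x != 0 -> 0 < ip (A x) x.

(* T is the resolvent (A - l)^{-1}. *)
Definition compact_resolvent A := exists (l : R) (T : H -> H),
  [/\ forall y, pdom A (T y) /\ A (T y) - l *: T y = y,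
      forall x, pdom A x -> T (A x - l *: x) = x &
      forall B : set H, bounded_set B -> precompact (T @` B)].

(* S = A^{1/2}, the positive self-adjoint operator with S^2 = A (domains
   included). *)
Definition is_sqrt_op A S :=
  [/\ self_adjoint S, positive_op S,
      forall x, pdom A x <-> pdom S x /\ pdom S (S x) &
      forall x, pdom A x -> A x = S (S x)].

End Operators.

Section Problem.
Context {R : realType} {H : completeNormedModType R} (ip : {dot H for idfun}).
(* S is A^{1/2}. *)
Variable S : pop H.
Local Notation HH := (H * H)%type.

Definition H12 : nspace H := NSpace (pdom S) (fun u => `|S u|).

(* (.,.) on H x H; the max norm that the library puts on H * H is not used. *)
Definition ipb (U W : HH) : R := ip U.1 W.1 + ip U.2 W.2.

Definition Hbar : nspace HH := NSpace setT (fun U => Num.sqrt (ipb U U)).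

Definition Hbar12 : nspace HH :=
  NSpace [set U | pdom S U.1 /\ pdom S U.2]
         (fun U => Num.sqrt (`|S U.1| ^+ 2 + `|S U.2| ^+ 2)).

Definition phase : nspace (HH * HH)%type :=
  NSpace [set Y | carrier Hbar12 Y.1]
         (fun Y => Num.sqrt (nrm Hbar12 Y.1 ^+ 2 + nrm Hbar Y.2 ^+ 2)).

(* (calA^{1/2} U, calA^{1/2} W), which is also the duality (calA U, W) between
   Hbar^{-1/2} and Hbar^{1/2}. *)
Definition Aform (nu1 nu2 : R) (U W : HH) : R :=
  nu1 * ip (S U.1) (S W.1) + nu2 * ip (S U.2) (S W.2).

Definition matop (K : 'I_2 -> 'I_2 -> H -> H) (U : HH) : HH :=
  (K 0 0 U.1 + K 0 1 U.2, K 1 0 U.1 + K 1 1 U.2).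

Definition diagop (B : 'I_2 -> H -> H) (U : HH) : HH := (B 0 U.1, B 1 U.2).

Definition sumfun (P : 'I_2 -> H -> R) (U : HH) : R := P 0 U.1 + P 1 U.2.

Definition sym_nonneg (T : HH -> HH) :=
  (forall U W, carrier Hbar12 U -> carrier Hbar12 W ->
     ipb (T U) W = ipb (T W) U) /\
  (forall U, carrier Hbar12 U -> 0 <= ipb (T U) U).

Definition bounded_op (T : HH -> HH) := exists M : R,
  forall U, carrier Hbar12 U -> nrm Hbar (T U) <= M * nrm Hbar12 U.

Definition locally_lipschitz_op (B : H -> H) := forall rho : R, 0 < rho ->
  exists L : R, forall u v, carrier H12 u -> carrier H12 v ->
    nrm H12 u <= rho -> nrm H12 v <= rho ->
    `|B u - B v| <= L * nrm H12 (u - v).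

Definition is_potential (B : H -> H) (P : H -> R) :=
  forall u, carrier H12 u -> forall e : R, 0 < e ->
  exists2 d : R, 0 < d & forall w, carrier H12 w -> 0 < nrm H12 w < d ->
    (nrm H12 w)^-1 * `|P (u + w) - P u - ip (B u) w| <= e.

(* P0 >= 0 is bounded on balls of H^{1/2} (the sense in which "locally" is also
   used for the Lipschitz property), and P1 is dominated by P0. *)
Definition admissible_potential (P0 P1 : H -> R) :=
  [/\ forall u, carrier H12 u -> 0 <= P0 u,
      forall rho : R, 0 < rho -> exists M : R,
        forall u, carrier H12 u -> nrm H12 u <= rho -> P0 u <= M &
      forall eta : R, 0 < eta -> exists C : R, forall u, carrier H12 u ->
        `|P1 u| <= eta * (`|S u| ^+ 2 + P0 u) + C].

Variables (nu1 nu2 : R).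

(* F in Hbar represents the element calA U + D W of Hbar^{-1/2}. *)
Definition represents (D : HH -> HH) (U W F : HH) :=
  forall Phi, carrier Hbar12 Phi ->
    Aform nu1 nu2 U Phi + ipb (D W) Phi = ipb F Phi.

(* U in C([0,T]; Hbar^{1/2}) and in C^1([0,T]; Hbar), with derivative Ut and
   initial data (U0, U1). *)
Definition regular_path (T : R) (U Ut : R -> HH) (U0 U1 : HH) :=
  [/\ cont_on Hbar12 `[0, T] U,
      forall t, t \in `[0, T] -> deriv_in Hbar `[0, T] U t (Ut t),
      cont_on Hbar `[0, T] Ut,
      U 0 = U0 &
      Ut 0 = U1].

Definition strong_solution (D K B : HH -> HH) (kappa T : R)
    (U Ut : R -> HH) (U0 U1 : HH) :=
  [/\ regular_path T U Ut U0 U1,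
      forall a b : R, 0 < a -> a < b -> b < T -> W11 Hbar12 a b U,
      forall a b : R, 0 < a -> a < b -> b < T -> W11 Hbar a b Ut &
      {ae lebesgue_measure, forall t, t \in `]0, T[ ->
         carrier Hbar12 (Ut t) /\
         exists F Utt : HH,
           [/\ represents D (U t) (Ut t) F,
               deriv_in Hbar `[0, T] Ut t Utt &
               Utt + F + kappa *: K (U t) + B (U t) = 0]}].

Definition generalized_solution (D K B : HH -> HH) (kappa T : R)
    (U Ut : R -> HH) (U0 U1 : HH) :=
  regular_path T U Ut U0 U1 /\
  exists Un Unt : nat -> R -> HH,
    (forall n, strong_solution D K B kappa T (Un n) (Unt n) (Un n 0) (Unt n 0))
    /\
    forall e : R, 0 < e -> \forall n \near \oo, forall t, t \in `[0, T] ->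
      nrm Hbar (Ut t - Unt n t)
        + Num.sqrt (Aform nu1 nu2 (U t - Un n t) (U t - Un n t)) <= e.

(* t |-> St t (U0, U1) = (U(t), U_t(t)) is the generalized solution with data
   (U0, U1), on every interval [0, T]. *)
Definition generated_by (D K B : HH -> HH) (kappa : R)
    (St : R -> HH * HH -> HH * HH) :=
  forall U0 U1, carrier Hbar12 U0 -> forall T, 0 < T ->
    generalized_solution D K B kappa T
      (fun t => (St t (U0, U1)).1) (fun t => (St t (U0, U1)).2) U0 U1.

Definition frakB (K : HH -> HH) (kappa r : R) : set (HH * HH) :=
  [set Y | carrier phase Y /\
     nrm Hbar Y.2 ^+ 2 + Aform nu1 nu2 Y.1 Y.1 + kappa * ipb (K Y.1) Y.1
       <= r ^+ 2].

End Problem.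

(* Main.v *)
Require Import Defs.
From mathcomp Require Import ring lra measurable_realfun.
Set Implicit Arguments.
Unset Strict Implicit.
Unset Printing Implicit Defensive.

(* Write k = kappa and D = D0 + alpha K.  The energy
     E = (|U_t|^2 + |calA^{1/2} U|^2 + k (K U, U)) / 2 + Pi(U)
   does not increase along solutions.  Its perturbation
     W = E + eps [(U, U_t) + (D U, U) / 2]
   grows with alpha, so an inequality W' <= - gamma W + C would only give an
   absorbing ball that depends on alpha.  Instead, with eps, c1 and C2
   independent of (alpha, kappa),
     W' <= - eps c1 (E - C2),
   and W is bounded below by a constant independent of (alpha, kappa) because
   D >= 0.  As E is nonincreasing, E(t) - C2 is at most the mean of E - C2 over
   [0, t], which is O(1/t); hence E <= C2 + 1 after a time that depends on the
   data and on (alpha, kappa), while the level C2 + 1 does not.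

   Along strong solutions W is absolutely continuous with an a.e. bounded
   derivative; generalized solutions are limits of strong ones.  Continuity of
   the quadratic forms on the phase space needs A^{1/2} to be bounded below, which
   comes from the compact resolvent, and K and D to be bounded as forms, which
   follows from symmetry and the uniform boundedness principle. *)

(** * Absolutely continuous functions *)

(** The damping form has a lower bound uniform in alpha but no upper one, so D may enter the
    estimates only with a favourable sign. The condition [eps <= c0 / 2] lets (D U_t, U_t) absorb
    the terms eps |U_t|^2, and (D U, U) is simply dropped when W is bounded below; the other
    conditions on [eps] keep the cross term eps (U, U_t) below a part of E. Paths in the phase space
    are differentiable only almost everywhere, and nothing is integrated: the tool is a mean value
    inequality for absolutely continuous real functions whose upper slope is almost everywhere at
    most a constant m. A constant is enough, because E is nonincreasing, so that its value at the
    right end of an interval bounds E from below on the whole interval. The resulting inequality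
    involves only values at the two ends and therefore survives the passage from strong to
    generalized solutions. Strong solutions are regular only inside ]0, T[, so the estimate starts
    at a small positive time, reached from the initial data by continuity. *)

(** The points x with [Q a x] have a supremum; the local property there, with transitivity, reaches
    the supremum and then passes it unless it is b. This takes the place of compactness whenever
    local estimates are glued. *)
Lemma cousin (R : realType) (a b : R) (Q : R -> R -> Prop) : a <= b ->
  (forall c d e, Q c d -> Q d e -> Q c e) ->
  (forall x, a <= x <= b -> exists2 d, 0 < d & forall c e,
     a <= c <= x -> x <= e <= b -> x - d < c -> e < x + d -> Q c e) ->
  Q a b.
Proof.
move=> ab Qtr Qloc.
have [da da0 Qa] : exists2 d, 0 < d & forall c e,
     a <= c <= a -> a <= e <= b -> a - d < c -> e < a + d -> Q c e.
  by apply: Qloc; rewrite lexx.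
have Qaa : Q a a by apply: Qa; rewrite ?lexx//; lra.
pose E := [set x | a <= x <= b /\ Q a x].
have Ea : E a by split=> //; rewrite lexx.
have supE : has_sup E by split; [exists a|exists b => x [/andP[]]].
have as' : a <= sup E by apply: ub_le_sup => //; case: supE.
have sb : sup E <= b by apply: ge_sup; [exists a|move=> x [/andP[]]].
have [d d0 Qd] := Qloc (sup E) (introT andP (conj as' sb)).
have [y [/andP[ay yb] Qy] ys] := sup_adherent d0 supE.
have ysup : y <= sup E by apply: ub_le_sup; [case: supE|split=> //; rewrite ay].
pose z := Num.min b (sup E + d / 2).
have zsup : sup E <= z by rewrite /z le_min sb /=; lra.
have zb : z <= b by rewrite /z ge_min lexx.
have zd : z < sup E + d by rewrite /z gt_min; apply/orP; right; lra.
have Qz : Q a z.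
  by apply: Qtr Qy _; apply: Qd => //; rewrite ?ay ?zsup.
have zs : z <= sup E.
  apply: ub_le_sup; first by case: supE.
  by split=> //; rewrite zb andbT (le_trans as').
move: zs Qz; rewrite /z; have [bs|] := leP b (sup E + d / 2) => //.
lra.
Qed.

(** Multiplying the difference quotient by (s - t)^2 gives one inequality, free of division, that
    bounds the slope by m on both sides of t. *)
Definition upper_slope_le (R : realType) (f : R -> R) (a b t m : R) :=
  exists2 d : R, 0 < d & forall s, `|s - t| < d -> a <= s <= b ->
    (s - t) * (f s - f t) <= m * (s - t) ^+ 2.

(** Adding the bounds on the two sides of t gives the estimate on intervals that contain t, the form
    that [cousin] consumes. *)
Lemma upper_slope_le_incr (R : realType) (f : R -> R) (a b t m : R) :
  upper_slope_le f a b t m -> exists2 d, 0 < d & forall c e,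
    a <= c <= t -> t <= e <= b -> t - d < c -> e < t + d ->
    f e - f c <= m * (e - c).
Proof.
move=> [d d0 ft]; exists d => // c y /andP[ac ct] /andP[ty yb] cd yd.
have h1 : f y - f t <= m * (y - t).
  have [->|yt] := eqVneq y t; first by rewrite !subrr mulr0.
  have yt0 : 0 < y - t by rewrite subr_gt0 lt_neqAle eq_sym yt.
  rewrite -(ler_pM2l yt0) mulrCA -expr2.
  by apply: ft; [rewrite gtr0_norm//; lra|rewrite yb andbT; lra].
have h2 : f t - f c <= m * (t - c).
  have [->|ct'] := eqVneq c t; first by rewrite !subrr mulr0.
  have ct0 : 0 < t - c by rewrite subr_gt0 lt_neqAle ct'.
  rewrite -(ler_pM2l ct0) mulrCA -expr2 -sqrrN opprB.
  rewrite (_ : (t - c) * (f t - f c) = (c - t) * (f c - f t)); last by ring.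
  by apply: ft; [rewrite ltr0_norm; lra|rewrite ac/=; lra].
lra.
Qed.

Lemma upper_slope_le_mvt (R : realType) (a b m : R) (f : R -> R) : a <= b ->
  (forall t e, a <= t <= b -> 0 < e -> upper_slope_le f a b t (m + e)) ->
  f b - f a <= m * (b - a).
Proof.
move=> ab fm; apply/ler_addgt0Pr => e0 e0_gt0.
(* The summand 1 keeps the denominator positive when a = b. *)
pose e := e0 / (1 + (b - a)).
have e_gt0 : 0 < e by rewrite divr_gt0//; lra.
have : f b - f a <= (m + e) * (b - a).
  apply: (@cousin _ a b (fun c d => f d - f c <= (m + e) * (d - c))) => //.
  - by move=> c d x; lra.
  - by move=> x xab; apply: upper_slope_le_incr; exact: fm.
have -> : e0 = e * (1 + (b - a)) by rewrite /e divfK//; lra.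
lra.
Qed.

(* Interval families are increasing sequences, so that families on adjacent
   intervals can be concatenated. *)
Definition ac_incr (R : realType) (a b : R) (F : R -> R -> R) :=
  forall e : R, 0 < e -> exists2 d : R, 0 < d &
    forall s : seq (R * R),
      (forall p, p \in s -> a <= p.1 /\ p.1 <= p.2 /\ p.2 <= b) ->
      pairwise (fun p q : R * R => p.2 <= q.1) s ->
      \sum_(p <- s) (p.2 - p.1) < d ->
      \sum_(p <- s) F p.1 p.2 < e.

Lemma abs_cont_incr (R : realType) (V : lmodType R) (X : nspace V) a b
    (f : R -> V) : abs_cont_on X a b f ->
  ac_incr a b (fun l r => nrm X (f r - f l)).
Proof.
move=> fac e e0; have {fac} [d d0 fac] := fac e e0.
exists d => // s sab sdis.
rewrite !(big_nth (0, 0)) !big_mkord => sd.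
pose l (i : 'I_(size s)) := (nth (0, 0) s i).1.
pose r (i : 'I_(size s)) := (nth (0, 0) s i).2.
apply: (fac _ l r) => //.
  by move=> i; apply: sab; rewrite mem_nth.
move/(pairwiseP (0, 0)) : sdis => sdis i j ij.
have [ltij|ltji|/val_inj eij] := ltngtP i j.
- by left; apply: (sdis i j _ _ ltij); rewrite inE.
- by right; apply: (sdis j i _ _ ltji); rewrite inE.
- by rewrite eij eqxx in ij.
Qed.

Lemma ac_incrD (R : realType) (a b : R) (F G : R -> R -> R) :
  ac_incr a b F -> ac_incr a b G -> ac_incr a b (fun l r => F l r + G l r).
Proof.
move=> Fac Gac e e0.
have e20 : 0 < e / 2 by rewrite divr_gt0.
have [d d0 Fd] := Fac _ e20; have [d' d'0 Gd] := Gac _ e20.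
exists (Num.min d d'); first by rewrite lt_min d0.
move=> s sab sdis; rewrite lt_min => /andP[sd sd'].
rewrite big_split/= [e]splitr; apply: ltrD; [exact: Fd|exact: Gd].
Qed.

Lemma ac_incr_le (R : realType) (a b M : R) (F G : R -> R -> R) :
  ac_incr a b F ->
  (forall l r, a <= l -> l <= r -> r <= b -> 0 <= F l r /\ G l r <= M * F l r) ->
  ac_incr a b G.
Proof.
move=> Fac GF e e0.
have M1 : 0 < `|M| + 1 by rewrite ltr_wpDl.
have [d d0 Fd] := Fac _ (divr_gt0 e0 M1).
exists d => // s sab sdis sd.
apply: (@le_lt_trans _ _ ((`|M| + 1) * \sum_(p <- s) F p.1 p.2)); last first.
  by rewrite -ltr_pdivlMl// mulrC; exact: Fd.
rewrite mulr_sumr big_seq [leRHS]big_seq; apply: ler_sum => p /sab [h1 [h2 h3]].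
have [F0 GM] := GF _ _ h1 h2 h3.
rewrite (le_trans GM)// ler_wpM2r// (le_trans (ler_norm _))//; lra.
Qed.

(* Off a null set N the increments are controlled by the derivative; N is covered
   by an open set of small measure, where absolute continuity takes over.  The two
   local estimates are glued by Cousin's lemma. *)
Lemma ac_incr_ae_derive_le (R : realType) (a b m : R) (f : R -> R) :
  a <= b ->
  ac_incr a b (fun l r => `|f r - f l|) ->
  {ae lebesgue_measure, forall t : R, a < t < b ->
     forall e, 0 < e -> upper_slope_le f a b t (m + e)} ->
  f b - f a <= m * (b - a).
Proof.
move=> ab fac [N [mN N0 fN]].
apply/ler_addgt0Pr => e0 e0_gt0.
(* The slope excess costs e (b - a); the variation of f over the cover and [|m|] times the length of
   the cover cost e each. *)
pose e := e0 / (2 + (b - a)).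
have e_gt0 : 0 < e by rewrite divr_gt0//; lra.
have [d2 d2_gt0 fd] := fac _ e_gt0.
have m1_gt0 : 0 < `|m| + 1 by rewrite ltr_wpDl.
pose d := Num.min d2 (e / (`|m| + 1)).
have d_gt0 : 0 < d by rewrite lt_min d2_gt0 divr_gt0.
(* The slope bound is assumed only in the open interval, so the end points join the exceptional
   set. *)
pose N' := N `|` [set a; b].
have mN' : measurable N' by apply: measurableU => //; apply: measurableU.
have N'0 : lebesgue_measure N' = 0.
  apply/eqP; rewrite -measure_le0.
  rewrite (le_trans (measureU2 _ _ _))//=; first by apply: measurableU.
  rewrite [X in (X + _)%E]N0 add0e.
  rewrite (le_trans (measureU2 _ _ _))//=.
  by rewrite !lebesgue_measure_set1 adde0.
have [G [oG N'G muG]] : exists G : set R,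
    [/\ open G, N' `<=` G & (lebesgue_measure G < d%:E)%E].
  have N'oo : (lebesgue_measure N' < +oo)%E by rewrite N'0.
  have [G [oG N'G muG]] := lebesgue_regularity_outer mN' N'oo d_gt0.
  exists G; split=> //.
  rewrite (le_lt_trans _ muG)//.
  rewrite -[X in (lebesgue_measure X <= _)%E](@setDUK _ N' G)//.
  rewrite (le_trans (measureU2 _ _ _))//=.
    by apply: measurableD => //; exact: open_measurable.
  by rewrite N'0 add0e.
have mG : measurable G by exact: open_measurable.
(* The family s collects the intervals tagged in N'. Bounding its length by the measure of the part
   of G in ]c, e1], which is additive, is what lets families be concatenated. The term in [|m|] pays
   for m (e1 - c), possibly negative, being counted on the intervals of s as well. *)
pose Q c e1 := c <= e1 /\ exists s : seq (R * R),
  [/\ forall p, p \in s -> c <= p.1 /\ p.1 <= p.2 /\ p.2 <= e1,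
      pairwise (fun p q : R * R => p.2 <= q.1) s,
      ((\sum_(p <- s) (p.2 - p.1))%:E <= lebesgue_measure (G `&` `]c, e1]))%E &
      f e1 - f c <= (m + e) * (e1 - c) + \sum_(p <- s) (`|f p.2 - f p.1| + `|m| * (p.2 - p.1))].
have [_ [s [sab sdis smu sf]]] : Q a b.
  apply: cousin => //.
  - move=> c x y [cx [s1 [s1ab s1dis s1mu s1f]]] [xy [s2 [s2ab s2dis s2mu s2f]]].
    split; first exact: le_trans xy.
    exists (s1 ++ s2); split.
    + move=> p; rewrite mem_cat => /orP[/s1ab|/s2ab] [? [? ?]].
        by split=> //; split=> //; exact: le_trans xy.
      by split=> //; exact: le_trans cx _.
    + rewrite pairwise_cat s1dis s2dis !andbT.
      apply/allrelP => p q /s1ab [_ [_ h1]] /s2ab [h2 _].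
      exact: le_trans h1 h2.
    + rewrite big_cat/= EFinD.
      have -> : G `&` `]c, y] = (G `&` `]c, x]) `|` (G `&` `]x, y]).
        rewrite -setIUr; congr (_ `&` _).
        apply/seteqP; split => z /=; rewrite !in_itv/=.
          move=> /andP[cz zy]; have [zx|xz] := leP z x; first by left; rewrite cz.
          by right; rewrite zy.
        by case=> /andP[h1 h2]; apply/andP; split=> //; lra.
      rewrite measureU//; first exact: leeD.
      * exact: measurableI.
      * exact: measurableI.
      * apply/seteqP; split => z //=; rewrite !in_itv/=.
        by move=> [[_ /andP[h1 h2]] [_ /andP[h3 h4]]]; lra.
    + rewrite big_cat/=; move: s1f s2f.
      set S1 := \sum_(_ <- s1) _; set S2 := \sum_(_ <- s2) _ => s1f s2f.
      lra.
  - move=> x xab.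
    have [xN|xN] := pselect (N' x).
      have h : \forall r0 \near 0^'+, ball x r0 `<=` G by apply: open_subball => //; exact: N'G.
      have [r r0 xr] : exists2 r, 0 < r & ball x r `<=` G.
        have [r [r0 xr]] := filter_ex (filterI (nbhs_right_gt 0) h).
        by exists r.
      exists r => // c y /andP[ac cx] /andP[xy yb] cd yd.
      have cy : c <= y by exact: le_trans xy.
      split=> //; exists [:: (c, y)]; split=> //.
      * by move=> p; rewrite inE => /eqP ->.
      * rewrite big_seq1/= (_ : G `&` _ = `]c, y]%classic); last first.
          apply/setIidr => z /=; rewrite in_itv/= => /andP[cz zy].
          by apply: xr; rewrite /ball/= ltr_distlC; apply/andP; split; lra.
        rewrite lebesgue_measure_itv/= lte_fin; case: ltP => // yc.
        by rewrite lee_fin subr_le0.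
      * rewrite big_seq1/=.
        have h1 : - `|m| * (y - c) <= m * (y - c).
          by rewrite ler_wpM2r ?subr_ge0// lerNl -normrN ler_norm.
        have h2 : 0 <= e * (y - c) by rewrite mulr_ge0 ?subr_ge0// ltW.
        have h3 := ler_norm (f y - f c).
        lra.
    have xab' : a < x < b.
      move: xab => /andP[]; rewrite !le_eqVlt.
      move=> /orP[/eqP ax|->] /orP[/eqP bx|->] //.
      * by exfalso; apply: xN; right; left.
      * by exfalso; apply: xN; right; left.
      * by exfalso; apply: xN; right; right.
    have fx : forall e, 0 < e -> upper_slope_le f a b x (m + e).
      apply: contrapT => h; apply: xN; left; apply: fN => /= /(_ xab'); exact: h.
    have [r r0 fr] := upper_slope_le_incr (fx _ e_gt0).
    exists r => // c y acx xyb cr yr.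
    have cy : c <= y.
      by move: acx xyb => /andP[_ cx] /andP[xy _]; exact: le_trans xy.
    by split=> //; exists [::]; split; rewrite ?big_nil ?addr0//; exact: fr.
have lend : \sum_(p <- s) (p.2 - p.1) < d.
  rewrite -lte_fin (le_lt_trans smu)// (le_lt_trans _ muG)//.
  by apply: le_measure; rewrite ?inE//; exact: measurableI.
have ende : \sum_(p <- s) `|f p.2 - f p.1| < e.
  by apply: fd => //; rewrite (lt_le_trans lend)// /d ge_min lexx.
have lene : `|m| * \sum_(p <- s) (p.2 - p.1) <= e.
  have : \sum_(p <- s) (p.2 - p.1) <= e / (`|m| + 1).
    by rewrite (le_trans (ltW lend))// /d ge_min lexx orbT.
  rewrite ler_pdivlMr// => h.
  rewrite (le_trans _ h)// mulrC ler_wpM2l//; last by lra.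
  by rewrite big_seq; apply: sumr_ge0 => p /sab [_ [? _]]; rewrite subr_ge0.
have -> : e0 = e * (2 + (b - a)) by rewrite /e divfK//; lra.
move: sf; rewrite big_split/= -mulr_sumr => sf.
lra.
Qed.

Lemma lebesgue_ae_impl (R : realType) (P Q : R -> Prop) :
  (forall t, P t -> Q t) -> {ae lebesgue_measure, forall t, P t} ->
  {ae lebesgue_measure, forall t, Q t}.
Proof.
move=> PQ; exact: (@filterS _ _ (ae_filter_ringOfSetsType lebesgue_measure)).
Qed.

Lemma lebesgue_ae_and (R : realType) (P Q : R -> Prop) :
  {ae lebesgue_measure, forall t, P t} ->
  {ae lebesgue_measure, forall t, Q t} ->
  {ae lebesgue_measure, forall t, P t /\ Q t}.
Proof.
move=> aP aQ; apply: (@filterI _ _ (ae_filter_ringOfSetsType lebesgue_measure)) => //.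
Qed.

(** * Seminorms and uniform boundedness *)

Section Forms.
Context {R : realType} {V : lmodType R} (f : V -> V -> R).
Hypotheses (fC : forall x y, f x y = f y x)
  (fP : forall a x y z, f (a *: x + y) z = a * f x z + f y z)
  (f0 : forall x, 0 <= f x x).

Lemma form_quad t x y :
  f (t *: x + y) (t *: x + y) = t ^+ 2 * f x x + 2 * t * f x y + f y y.
Proof. rewrite fP !(fC _ (t *: x + y)) !fP (fC y x); ring. Qed.

(** The quadratic polynomial of [form_quad] is nonnegative in t, hence the discriminant bound. The
    form is only semidefinite, so f x x = 0 is a separate case. *)
Lemma form_CS x y : `|f x y| <= Num.sqrt (f x x) * Num.sqrt (f y y).
Proof.
rewrite -sqrtrM// -sqrtr_sqr ler_sqrt ?mulr_ge0//.
have h t : 0 <= t ^+ 2 * f x x + 2 * t * f x y + f y y by rewrite -form_quad.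
have [x0|x0] := eqVneq (f x x) 0.
  have [->|xy0] := eqVneq (f x y) 0; first by rewrite expr0n x0 mul0r.
  (* With f x x = 0 the polynomial is affine in t, and it equals -1 at this point. *)
  have := h (- (f y y + 1) / (2 * f x y)); rewrite x0 mulr0 add0r.
  rewrite (_ : 2 * _ * f x y = - (f y y + 1)); last by field.
  lra.
have xgt0 : 0 < f x x by rewrite lt_neqAle eq_sym x0 f0.
have := h (- f x y / f x x).
rewrite (_ : _ + f y y = (f x x * f y y - f x y ^+ 2) / f x x); last by field.
by rewrite pmulr_lge0 ?invr_gt0// subr_ge0.
Qed.

Lemma form_triangle x y :
  Num.sqrt (f (x + y) (x + y)) <= Num.sqrt (f x x) + Num.sqrt (f y y).
Proof.
rewrite -[leRHS]ger0_norm ?addr_ge0 ?sqrtr_ge0// -sqrtr_sqr ler_sqrt ?sqr_ge0//.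
have := form_quad 1 x y; rewrite scale1r => ->.
rewrite sqrrD !sqr_sqrtr//.
have := le_trans (ler_norm _) (form_CS x y); lra.
Qed.

Lemma form_scale a x : Num.sqrt (f (a *: x) (a *: x)) = `|a| * Num.sqrt (f x x).
Proof.
have fZ b u z : f (b *: u) z = b * f u z.
  have f00 : f 0 z = 0.
    by have := fP 1 0 0 z; rewrite scaler0 addr0 mul1r => h; lra.
  by have := fP b u 0 z; rewrite addr0 f00 addr0.
by rewrite fZ fC fZ mulrA -expr2 sqrtrM ?sqr_ge0// sqrtr_sqr.
Qed.
End Forms.

Section NormedSubspaces.
Context {R : realType} {V : lmodType R}.

(** An [nspace] is bare data. Homogeneity and subadditivity are asked on the carrier only, because
    an unbounded operator such as A^{1/2} is linear only on its domain. *)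
Record seminormed (X : nspace V) : Prop := Seminormed {
  sn_sub : lin_subspace (carrier X) ;
  sn_ge0 : forall x, 0 <= nrm X x ;
  sn_Z : forall a x, carrier X x -> nrm X (a *: x) = `|a| * nrm X x ;
  sn_D : forall x y, carrier X x -> carrier X y ->
    nrm X (x + y) <= nrm X x + nrm X y }.

Lemma linear_on0 (W : lmodType R) (D : set V) (L : V -> W) :
  lin_subspace D -> linear_on D L -> L 0 = 0.
Proof.
move=> [D0 _] LL; have := LL 1 0 0 D0 D0; rewrite !scale1r addr0 => h.
by apply: (@addrI _ (L 0)); rewrite -h addr0.
Qed.

Lemma linear_onZ (W : lmodType R) (D : set V) (L : V -> W) a x :
  lin_subspace D -> linear_on D L -> D x -> L (a *: x) = a *: L x.
Proof.
move=> D0 LL Dx; have := LL a x 0 Dx D0.1.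
by rewrite !addr0 (linear_on0 D0)// addr0.
Qed.

Lemma linear_onD (W : lmodType R) (D : set V) (L : V -> W) x y :
  linear_on D L -> D x -> D y -> L (x + y) = L x + L y.
Proof. by move=> LL Dx Dy; have := LL 1 x y Dx Dy; rewrite !scale1r. Qed.

Lemma linear_onB (W : lmodType R) (D : set V) (L : V -> W) x y :
  linear_on D L -> D x -> D y -> L (x - y) = L x - L y.
Proof.
move=> LL Dx Dy; have := LL (- 1) y x Dy Dx.
by rewrite !scaleN1r addrC [- _ + _]addrC.
Qed.

(** All the norms in use are of this kind: the identity gives H x H, A^{1/2} gives H^{1/2}, and
    their products give the square of H^{1/2} and the phase space. *)
Lemma seminormed_form (W : lmodType R) (X : nspace V) (L : V -> W)
    (f : W -> W -> R) :
  (forall x y, f x y = f y x) ->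
  (forall a x y z, f (a *: x + y) z = a * f x z + f y z) ->
  (forall x, 0 <= f x x) ->
  lin_subspace (carrier X) -> linear_on (carrier X) L ->
  (forall x, nrm X x = Num.sqrt (f (L x) (L x))) -> seminormed X.
Proof.
move=> fC fP f0 sX LL nE; split=> //.
- by move=> x; rewrite nE sqrtr_ge0.
- by move=> a x Xx; rewrite !nE (linear_onZ _ sX)// form_scale.
- by move=> x y Xx Xy; rewrite !nE (linear_onD LL)// form_triangle.
Qed.

Context (X : nspace V) (sX : seminormed X).

Lemma sn0 : carrier X 0. Proof. exact: (sn_sub sX).1. Qed.
Lemma sn_cD x y : carrier X x -> carrier X y -> carrier X (x + y).
Proof. by move=> Xx Xy; have := (sn_sub sX).2 1 x y Xx Xy; rewrite scale1r. Qed.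
Lemma sn_cZ a x : carrier X x -> carrier X (a *: x).
Proof. by move=> Xx; have := (sn_sub sX).2 a x 0 Xx sn0; rewrite addr0. Qed.
Lemma sn_cN x : carrier X x -> carrier X (- x).
Proof. by move=> Xx; rewrite -scaleN1r; exact: sn_cZ. Qed.
Lemma sn_cB x y : carrier X x -> carrier X y -> carrier X (x - y).
Proof. by move=> Xx Xy; apply: sn_cD => //; exact: sn_cN. Qed.
Lemma sn_n0 : nrm X 0 = 0.
Proof. by have := sn_Z sX 0 sn0; rewrite scale0r normr0 mul0r. Qed.
Lemma sn_N x : carrier X x -> nrm X (- x) = nrm X x.
Proof. by move=> Xx; rewrite -scaleN1r (sn_Z sX)// normrN normr1 mul1r. Qed.
Lemma sn_distC x y : carrier X x -> carrier X y -> nrm X (x - y) = nrm X (y - x).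
Proof. by move=> Xx Xy; rewrite -opprB sn_N//; exact: sn_cB. Qed.
Lemma sn_B x y : carrier X x -> carrier X y -> nrm X (x - y) <= nrm X x + nrm X y.
Proof. by move=> Xx Xy; rewrite -[nrm X y]sn_N//; apply: (sn_D sX) => //; exact: sn_cN. Qed.
Lemma sn_dist3 x y z : carrier X x -> carrier X y -> carrier X z ->
  nrm X (x - z) <= nrm X (x - y) + nrm X (y - z).
Proof.
move=> Xx Xy Xz; have -> : x - z = (x - y) + (y - z) by rewrite subrKA.
by apply: (sn_D sX) => //; exact: sn_cB.
Qed.

Definition complete_ns := forall x_ : nat -> V, (forall n, carrier X (x_ n)) ->
  (forall e : R, 0 < e -> exists N, forall m n,
     (N <= m)%N -> (N <= n)%N -> nrm X (x_ m - x_ n) <= e) ->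
  exists2 x, carrier X x & forall e : R, 0 < e -> exists N, forall n,
     (N <= n)%N -> nrm X (x - x_ n) <= e.

(** Summing the geometric series gives 4/3 in place of 2; the difference absorbs the distance from
    the limit to a far term. *)
Lemma complete_geometric (x_ : nat -> V) : complete_ns ->
  (forall n, carrier X (x_ n)) ->
  (forall n, nrm X (x_ n.+1 - x_ n) <= 4^-1 ^+ n) ->
  exists2 x, carrier X x & forall n, nrm X (x - x_ n) <= 2 * 4^-1 ^+ n.
Proof.
move=> cX Xx_ x_4.
have step n k : nrm X (x_ (n + k)%N - x_ n) <= 4 / 3 * 4^-1 ^+ n.
  have : nrm X (x_ (n + k)%N - x_ n) <= 4 / 3 * (4^-1 ^+ n - 4^-1 ^+ (n + k)).
    elim: k => [|k ih]; first by rewrite addn0 !subrr mulr0 sn_n0.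
    rewrite (le_trans (@sn_dist3 _ (x_ (n + k)%N) _ _ _ _))//.
    rewrite (le_trans (lerD (_ : _ <= 4^-1 ^+ (n + k)) ih))//; first by rewrite addnS.
    rewrite addnS exprS; lra.
  have : 0 <= 4^-1 ^+ (n + k) :> R by rewrite exprn_ge0.
  lra.
have p4 n : 0 < 4^-1 ^+ n :> R by rewrite exprn_gt0// invr_gt0.
have [e e0|x Xx xlim] := cX x_ Xx_.
  have : \forall N \near \oo, `|4^-1 ^+ N : R| < e / 4.
    have := @cvg_expr R 4^-1.
    rewrite ger0_norm// invf_lt1// ltr1n => /(_ isT) /cvgr0_norm_lt.
    by apply; rewrite divr_gt0.
  case=> N _ /(_ N (leqnn N)) /=; rewrite ger0_norm ?ltW// => hN.
  exists N => m n Nm Nn.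
  rewrite (le_trans (@sn_dist3 _ (x_ N) _ _ _ _))// [X in _ + X]sn_distC//.
  have := step N (m - N)%N; have := step N (n - N)%N; rewrite !subnKC//.
  lra.
exists x => // n.
have e0 : 0 < 4^-1 ^+ n / 2 :> R by rewrite divr_gt0.
have [N hN] := xlim _ e0.
have := hN (N + n)%N (leq_addr _ _); have := step n N.
rewrite addnC => h1 h2.
rewrite (le_trans (@sn_dist3 _ (x_ (N + n)%N) _ _ _ _))//.
have := p4 n; lra.
Qed.

(* Sokal's gliding hump: at each step the point is moved by 4^-n in a direction
   where a functional of norm at least 4^n n is almost maximal, with the sign that
   does not decrease its modulus; later moves are too small to undo the gain. *)
Lemma uniform_boundedness (I : Type) (f : I -> V -> R) : complete_ns ->
  (forall i, linear_on (W := R^o) (carrier X) (f i)) ->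
  (forall i, exists M, forall x, carrier X x -> `|f i x| <= M * nrm X x) ->
  (forall x, carrier X x -> exists M, forall i, `|f i x| <= M) ->
  exists M, forall i x, carrier X x -> `|f i x| <= M * nrm X x.
Proof.
move=> cX fL fB fpt; apply: contrapT => nB.
(* The hump needs directions that almost attain the norm, so the given bound is replaced by the
   exact operator norm, a supremum over the unit ball. *)
have opnorm i : exists N, [/\ 0 <= N, forall x, carrier X x -> `|f i x| <= N * nrm X x
    & forall m, m < N -> exists u, [/\ carrier X u, nrm X u <= 1 & m < f i u]].
  have [M fM] := fB i.
  pose E := [set r | exists u, [/\ carrier X u, nrm X u <= 1 & r = f i u]].
  have fi0 : f i 0 = 0 by exact: (linear_on0 (sn_sub sX) (fL i)).
  have E0 : E 0 by exists 0; rewrite sn_n0 fi0; split=> //; exact: sn0.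
  have ubE : has_sup E.
    split; first by exists 0.
    exists `|M| => _ [u [Xu u1 ->]].
    rewrite (le_trans (ler_norm _))// (le_trans (fM _ Xu))//.
    rewrite (le_trans (ler_wpM2r (sn_ge0 sX u) (ler_norm M)))//.
    by rewrite -[leRHS]mulr1 ler_wpM2l.
  exists (sup E); split.
  - by apply: ub_le_sup E0; case: ubE.
  - move=> x Xx.
    have [x0|x0] := eqVneq (nrm X x) 0.
      by have := fM x Xx; rewrite x0 !mulr0.
    have xgt0 : 0 < nrm X x by rewrite lt_neqAle eq_sym x0 (sn_ge0 sX).
    rewrite -ler_pdivrMr//.
    have hh (s : R) : `|s| = 1 -> s * f i x / nrm X x <= sup E.
      move=> s1; apply: ub_le_sup; first by case: ubE.
      exists ((s / nrm X x) *: x); split.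
      + exact: sn_cZ.
      + by rewrite (sn_Z sX)// normrM s1 normfV (gtr0_norm xgt0) mul1r mulVf.
      + rewrite (linear_onZ _ (sn_sub sX) (fL i) Xx) /GRing.scale/=; ring.
    have [p|n] := ger0P (f i x).
      by have := hh 1 (normr1 _); rewrite mul1r.
    by have := hh (- 1); rewrite normrN normr1 mulN1r; exact.
  - move=> m mE; have me : 0 < sup E - m by rewrite subr_gt0.
    have [_ [v [Xv v1 ->]] mv] := sup_adherent me ubE.
    by exists v; split=> //; rewrite subKr in mv.
have {}opnorm i : exists N, [/\ 0 <= N, forall x, carrier X x -> `|f i x| <= N * nrm X x
    & 0 < N -> exists u, [/\ carrier X u, nrm X u <= 1 & 3 / 4 * N < f i u]].
  have [N [N0 fN uN]] := opnorm i; exists N; split=> // Ngt0.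
  by apply: uN; lra.
have big (M : R) : 0 <= M -> exists p : I * R * V, [/\ M < p.1.2,
    forall x, carrier X x -> `|f p.1.1 x| <= p.1.2 * nrm X x, carrier X p.2,
    nrm X p.2 <= 1 & 3 / 4 * p.1.2 < f p.1.1 p.2].
  move=> M0; apply: contrapT => np; apply: nB; exists M => i x Xx.
  have [N [N0 fN uN]] := opnorm i.
  have [NM|MN] := leP N M; first by rewrite (le_trans (fN _ Xx))// ler_wpM2r// (sn_ge0 sX).
  have [u [Xu u1 fu]] := uN (le_lt_trans M0 MN).
  by exfalso; apply: np; exists (i, N, u).
have /choice[P hP] : forall n : nat, exists p : I * R * V, [/\ 4 * 4 ^+ n * n%:R < p.1.2,
    forall x, carrier X x -> `|f p.1.1 x| <= p.1.2 * nrm X x, carrier X p.2,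
    nrm X p.2 <= 1 & 3 / 4 * p.1.2 < f p.1.1 p.2].
  by move=> n; apply: big; rewrite !mulr_ge0// exprn_ge0.
have P0 n : 0 < (P n).1.2.
  by case: (hP n) => h _ _ _ _; rewrite (le_lt_trans _ h)// !mulr_ge0// exprn_ge0.
have p4 n : 0 < 4^-1 ^+ n :> R by rewrite exprn_gt0// invr_gt0.
pose sg n x : R := if 0 <= f (P n).1.1 x then 4^-1 ^+ n else - 4^-1 ^+ n.
pose x_ := fix F (n : nat) : V := if n is m.+1 then F m + sg m (F m) *: (P m).2 else 0.
have Xx_ n : carrier X (x_ n).
  elim: n => [|n ih] /=; first exact: sn0.
  by apply: sn_cD => //; apply: sn_cZ; case: (hP n).
have x_4 n : nrm X (x_ n.+1 - x_ n) <= 4^-1 ^+ n.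
  rewrite /= addrAC subrr add0r; case: (hP n) => _ _ XP P1 _.
  rewrite (sn_Z sX)// -[leRHS]mulr1 /sg.
  by case: ifP => _; rewrite ?normrN gtr0_norm// ler_wpM2l// ltW.
have fx_ n : 3 / 4 * (P n).1.2 * 4^-1 ^+ n <= `|f (P n).1.1 (x_ n.+1)|.
  case: (hP n) => _ _ XP _ fP; rewrite /= (linear_onD (fL _))//; last exact: sn_cZ.
  rewrite (linear_onZ _ (sn_sub sX) (fL _) XP) /GRing.scale/=.
  have h := ler_wpM2r (ltW (p4 n)) (ltW fP).
  rewrite /sg; case: ifPn => [fx0|]; last rewrite -ltNge => fx0.
    by rewrite (le_trans _ (ler_norm _))//; lra.
  by rewrite -normrN (le_trans _ (ler_norm _))//; lra.
have [x Xx xx_] := complete_geometric cX Xx_ x_4.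
have [M fM] := fpt x Xx.
(* Let N be the norm of the n-th functional. After move n its modulus is at least 3/4 N 4^-n, and
   the remaining distance 2 * 4^-(n+1) to the limit loses at most half of N 4^-n. A quarter of N
   4^-n is left, which exceeds n since N > 4 * 4^n * n. *)
have fxn n : n%:R <= `|f (P n).1.1 x|.
  case: (hP n) => hN fN _ _ _.
  have h1 := fx_ n.
  have h2 := fN _ (sn_cB Xx (Xx_ n.+1)).
  have h3 : `|f (P n).1.1 (x_ n.+1)| <= `|f (P n).1.1 x| + `|f (P n).1.1 (x - x_ n.+1)|.
    rewrite (linear_onB (fL _))// distrC.
    rewrite -{1}[X in `|X|](subrK (f (P n).1.1 x)) addrC.
    exact: ler_normD.
  have h4 := ler_wpM2l (ltW (P0 n)) (xx_ n.+1).
  have h5 := ler_wpM2r (ltW (p4 n)) (ltW hN).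
  have e : 4 * 4 ^+ n * n%:R * 4^-1 ^+ n = 4 * n%:R :> R.
    have n0 : 4 ^+ n != 0 :> R by rewrite expf_neq0.
    by rewrite exprVn mulrAC -(mulrA 4) mulfV// mulr1.
  rewrite e in h5; rewrite exprS in h4.
  lra.
have := fxn (Num.truncn (`|M|)).+1.
have : `|M| < (Num.truncn (`|M|)).+1%:R by exact: truncnS_gt.
have := fM (P (Num.truncn `|M|).+1).1.1; have := ler_norm M.
lra.
Qed.
End NormedSubspaces.

(** * The square root of an operator with compact resolvent *)

Section InnerProduct.
Context {R : realType} {H : completeNormedModType R} (ip : {dot H for idfun}).
Hypothesis ip_norm : forall x, ip x x = `|x| ^+ 2.
Local Notation HH := (H * H)%type.

Lemma ipC x y : ip x y = ip y x.
Proof. by rewrite hermC /= expr0 mul1r. Qed.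

Lemma ipP a x y z : ip (a *: x + y) z = a * ip x z + ip y z.
Proof. by rewrite linearDl linearZl_LR. Qed.

Lemma ipPr a x y z : ip z (a *: x + y) = a * ip z x + ip z y.
Proof. by rewrite ipC ipP !(ipC z). Qed.

Lemma ip_ge0 x : 0 <= ip x x.
Proof. by rewrite ip_norm sqr_ge0. Qed.

Lemma ip_CS x y : `|ip x y| <= `|x| * `|y|.
Proof.
have := form_CS ipC ipP ip_ge0 x y.
by rewrite !ip_norm !sqrtr_sqr !normr_id.
Qed.

Lemma ipbC (U W : HH) : ipb ip U W = ipb ip W U.
Proof. by rewrite /ipb ipC (ipC U.2). Qed.

Lemma ipbP a (U W Z : HH) :
  ipb ip (a *: U + W) Z = a * ipb ip U Z + ipb ip W Z.
Proof. by rewrite /ipb /= !ipP; ring. Qed.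

Lemma ipbPr a (U W Z : HH) :
  ipb ip Z (a *: U + W) = a * ipb ip Z U + ipb ip Z W.
Proof. by rewrite ipbC ipbP !(ipbC Z). Qed.

Lemma ipb_ge0 (U : HH) : 0 <= ipb ip U U.
Proof. by rewrite addr_ge0 ?ip_ge0. Qed.

Lemma ipb_nrm (U : HH) : ipb ip U U = nrm (Hbar ip) U ^+ 2.
Proof. by rewrite sqr_sqrtr// ipb_ge0. Qed.

Lemma ipb_CS (U W : HH) :
  `|ipb ip U W| <= nrm (Hbar ip) U * nrm (Hbar ip) W.
Proof. exact: form_CS ipbC ipbP ipb_ge0 _ _. Qed.

Lemma ipb0l (U : HH) : ipb ip 0 U = 0.
Proof. by have := ipbP 1 0 0 U; rewrite scaler0 addr0 mul1r => h; lra. Qed.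

Lemma ipbDl (U W Z : HH) : ipb ip (U + W) Z = ipb ip U Z + ipb ip W Z.
Proof. by have := ipbP 1 U W Z; rewrite scale1r mul1r. Qed.

Lemma ipbZl a (U Z : HH) : ipb ip (a *: U) Z = a * ipb ip U Z.
Proof. by have := ipbP a U 0 Z; rewrite ipb0l !addr0. Qed.

Lemma seminormed_Hbar : seminormed (Hbar ip).
Proof.
by apply: (seminormed_form (L := idfun) ipbC ipbP ipb_ge0).
Qed.

Lemma complete_seq (y_ : nat -> H) :
  (forall e : R, 0 < e -> exists N, forall m n,
     (N <= m)%N -> (N <= n)%N -> `|y_ m - y_ n| <= e) ->
  exists y, forall e : R, 0 < e -> exists N, forall n,
     (N <= n)%N -> `|y - y_ n| <= e.
Proof.
move=> yc.
have /cauchy_cvgP ycv : cauchy (y_ @ \oo).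
  apply/cauchy_exP => e e0.
  have e20 : 0 < e / 2 by rewrite divr_gt0.
  have [N hN] := yc _ e20.
  exists (y_ N), N => // n Nn; rewrite -ball_normE /=.
  by rewrite (le_lt_trans (hN _ _ _ _))// ltr_pdivrMr// ltr_pMr// ltr1n.
exists (lim (y_ @ \oo)) => e e0.
have /cvgrPdist_le /(_ _ e0) [N _ hN] := ycv.
by exists N => n /hN.
Qed.

Section SelfAdjoint.
Variable S : pop H.
Hypothesis saS : self_adjoint ip S.

(** The graph of S is closed: (S z, x) = (z, y) passes to the limit, so x lies in the domain of the
    adjoint, which is that of S; then S x - y is orthogonal to a dense set. *)
Lemma self_adjoint_closed x y :
  (forall e : R, 0 < e -> exists u, [/\ pdom S u, `|x - u| <= e & `|y - S u| <= e]) ->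
  pdom S x /\ S x = y.
Proof.
case: saS => sub lin dns symm adj xy.
have adjxy z : pdom S z -> ip (S z) x = ip z y.
  move=> Sz; apply/eqP; rewrite -subr_eq0 -normr_le0.
  apply/ler_addgt0Pr => e e0; rewrite add0r.
  pose M := `|S z| + `|z| + 1.
  have M0 : 0 < M by rewrite ltr_wpDl// addr_ge0.
  have [u [Su xu yu]] := xy _ (divr_gt0 e0 M0).
  have -> : ip (S z) x - ip z y = ip (S z) (x - u) - ip z (y - S u).
    by rewrite !linearBr /= (symm z u)//; ring.
  rewrite (le_trans (ler_normB _ _))// (le_trans (lerD (ip_CS _ _) (ip_CS _ _)))//.
  rewrite (le_trans (lerD (ler_wpM2l (normr_ge0 _) xu) (ler_wpM2l (normr_ge0 _) yu)))//.
  rewrite -mulrDl mulrA ler_pdivrMr// mulrC ler_wpM2l// ?ltW//.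
  by rewrite /M; lra.
have Sx : pdom S x by apply: (adj x y).
split=> //.
apply/eqP; rewrite -subr_eq0 -normr_le0; apply/ler_addgt0Pr => e e0; rewrite add0r.
have orth z : pdom S z -> ip z (S x - y) = 0.
  by move=> Sz; rewrite linearBr/= -symm// adjxy// subrr.
move: (S x - y) orth => w orth.
have [z [wz Sz]] : ball w e `&` pdom S !=set0.
  by apply: dns; [exists w; exact: ballxx|exact: ball_open].
have [w0|w0] := eqVneq w 0; first by rewrite w0 normr0 ltW.
have wgt0 : 0 < `|w| by rewrite normr_gt0.
rewrite -(ler_pM2l wgt0) -expr2 -ip_norm.
have -> : ip w w = ip (w - z) w by rewrite linearBl/= (orth z)// subr0.
rewrite (le_trans (ler_norm _))// (le_trans (ip_CS _ _))// mulrC ler_wpM2l//.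
by move: wz; rewrite -ball_normE /= => /ltW.
Qed.

Lemma self_adjointZ a x : pdom S x -> pdom S (a *: x) /\ S (a *: x) = a *: S x.
Proof.
case: saS => sub lin _ _ _ Sx; split; last exact: linear_onZ sub lin _.
by rewrite -[_ *: _]addr0; apply: sub.2 => //; exact: sub.1.
Qed.

End SelfAdjoint.

Section LowerBound.
Variables A S : pop H.
Hypotheses (saA : self_adjoint ip A) (resA : compact_resolvent A)
  (sqS : is_sqrt_op ip A S).

(* If S u_n -> 0 with |u_n| = 1, then T u_n, which clusters at some y by
   compactness, satisfies S (T u_n) = T (S u_n) -> 0, so S y = 0 and y = 0;
   but (S T u_n, S u_n) = 1 + l (T u_n, u_n), a contradiction. *)
Lemma sqrt_op_lower_bound : exists2 c : R, 0 < c & forall u, pdom S u -> `|u| <= c * `|S u|.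
Proof.
case: sqS => saS posS domA AE; case: resA => l [T [TA AT cptT]].
have [subS linS _ symS _] := saS.
apply: contrapT => nc.
have /choice[u hu] : forall n : nat, exists u, [/\ pdom S u, `|u| = 1 & `|S u| <= n.+1%:R^-1].
  move=> n; apply: contrapT => nu; apply: nc; exists n.+1%:R => // u Su.
  have [->|u0] := eqVneq u 0; first by rewrite normr0 mulr_ge0.
  have ugt0 : 0 < `|u| by rewrite normr_gt0.
  rewrite leNgt; apply/negP => lt.
  apply: nu; exists (`|u|^-1 *: u).
  have [? ->] := self_adjointZ saS `|u|^-1 Su; split=> //.
    by rewrite normrZ normfV normr_id mulVf// gt_eqF.
  rewrite normrZ normfV normr_id mulrC ler_pdivrMr//.
  by rewrite ler_pdivlMl// ltW.
have TZ a y : T (a *: y) = a *: T y.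
  have [dTy eTy] := TA y.
  have [daTy eaTy] := self_adjointZ saA a dTy.
  by rewrite -[in LHS]eTy scalerBr -eaTy scalerA mulrC -scalerA AT.
(* S (S (T x)) = A (T x) = x + l T x is again in the domain of S, so S (T x) is in the domain of A,
   and A - l maps it to S x. *)
have TS x : pdom S x -> S (T x) = T (S x).
  move=> Sx; have [dTx eTx] := TA x.
  have ATx : A (T x) = x + l *: T x by rewrite -[X in X + _]eTx subrK.
  have [STx SSTx] := (domA _).1 dTx.
  have dATx : pdom S (A (T x)).
    by rewrite ATx addrC; apply: subS.2.
  have dSTx : pdom A (S (T x)) by apply/domA; split=> //; rewrite -AE.
  rewrite -(AT _ dSTx); congr T.
  by rewrite AE// -(AE (T x))// ATx [x + _]addrC linS// addrAC subrr add0r.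
pose C := closure (T @` [set x | `|x| <= 1]).
have cptC : compact C.
  rewrite -precompactE; apply: cptT.
  by exists 1; split => // r r1 z /= /le_trans; apply; exact: ltW.
(* The image of the unit ball has compact, hence bounded, closure; homogeneity of T does the
   rest. *)
have [M M0 TM] : exists2 M : R, 0 < M & forall x, `|T x| <= M * `|x|.
  have [M [_ hM]] := compact_bounded cptC.
  exists (`|M| + 1) => [|x]; first by rewrite ltr_wpDl.
  have [->|x0] := eqVneq x 0.
    by have := TZ 0 0; rewrite !scale0r => ->; rewrite !normr0 mulr0.
  have xgt0 : 0 < `|x| by rewrite normr_gt0.
  rewrite -ler_pdivrMr// mulrC.
  have -> : `|x|^-1 * `|T x| = `|T (`|x|^-1 *: x)| by rewrite TZ normrZ normfV normr_id.
  apply: hM; first by rewrite (le_lt_trans (ler_norm _))// ltrDl.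
  apply: subset_closure; exists (`|x|^-1 *: x) => //=.
  by rewrite normrZ normfV normr_id mulVf// gt_eqF.
have [y [_ cly]] : C `&` cluster ((T \o u) @ \oo) !=set0.
  apply: cptC; exists 0%N => // n _ /=.
  by apply: subset_closure; exists (u n) => //=; case: (hu n) => _ ->.
have near_y (N : nat) e : 0 < e -> exists2 n, (N <= n)%N & `|y - T (u n)| < e.
  move=> e0; have [ | |z []] := cly ((T \o u) @` [set n | (N <= n)%N]) (ball y e).
  - by exists N => // n /= Nn; exists n.
  - exact: nbhsx_ballx.
  by case=> n Nn <-; rewrite -ball_normE /= => h; exists n.
have small (e : R) : 0 < e -> exists N : nat, forall n, (N <= n)%N -> n.+1%:R^-1 <= e.
  move=> e0; exists (Num.truncn e^-1) => n Nn.
  by rewrite invf_ple ?posrE// ltW// (lt_le_trans (truncnS_gt _))// ler_nat ltnS.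
have [Sy Sy0] : pdom S y /\ S y = 0.
  apply: (self_adjoint_closed saS) => e e0.
  have [N hN] := small _ (divr_gt0 e0 M0).
  have [n Nn yn] := near_y N e e0.
  have [Sun un1 Sun0] := hu n.
  exists (T (u n)); split; [|exact: ltW|].
    by have [/domA[]] := TA (u n).
  rewrite TS// sub0r normrN (le_trans (TM _))// mulrC -ler_pdivlMr//.
  by rewrite (le_trans Sun0)// hN.
have y0 : y = 0.
  apply/eqP/negPn/negP => yn0; have := posS y Sy yn0.
  by rewrite Sy0 linear0l ltxx.
(* For a suitable n both (T S u_n, S u_n) and l (T u_n, u_n) have modulus at most 1/4, while their
   difference is |u_n|^2 = 1. *)
have M1 : 0 < 4 * (M + 1) by lra.
have l1 : 0 < 4 * (`|l| + 1) by rewrite mulr_gt0// ltr_wpDl.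
have [N hN] := small _ (divr_gt0 ltr01 M1).
have [n Nn yn] := near_y N _ (divr_gt0 ltr01 l1).
have [Sun un1 Sun0] := hu n.
have [dTu eTu] := TA (u n).
have [STu SSTu] := (domA _).1 dTu.
have : ip (A (T (u n))) (u n) = ip (S (T (u n))) (S (u n)).
  by rewrite AE// symS.
have -> : A (T (u n)) = l *: T (u n) + u n by rewrite -[X in _ + X]eTu addrC subrK.
rewrite ipP ip_norm un1 expr1n TS// => eq1.
have h1 : `|ip (T (S (u n))) (S (u n))| <= 1 / 4.
  rewrite (le_trans (ip_CS _ _))// -[leRHS]mulr1; apply: ler_pM => //.
    rewrite (le_trans (TM _))//.
    rewrite (le_trans (ler_wpM2l (ltW M0) (le_trans Sun0 (hN n Nn))))//.
    by rewrite mulrA mulr1 ler_pdivrMr//; lra.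
  by rewrite (le_trans Sun0)// invf_le1// ler1n.
have h2 : `|l * ip (T (u n)) (u n)| <= 1 / 4.
  rewrite normrM (le_trans (ler_wpM2l (normr_ge0 _) (ip_CS _ _)))// un1 mulr1.
  rewrite y0 sub0r normrN in yn.
  rewrite (le_trans (ler_wpM2l (normr_ge0 _) (ltW yn)))//.
  have := normr_ge0 l => l0.
  by rewrite mulrA mulr1 ler_pdivrMr//; lra.
have := ler_norm (ip (T (S (u n))) (S (u n))).
have := ler_norm (- (l * ip (T (u n)) (u n))).
rewrite normrN; lra.
Qed.

End LowerBound.
End InnerProduct.

(** * Differentiable functionals along paths *)

Section SmoothFunctionals.
Context {R : realType}.

(** Fréchet differentiability with a derivative bounded on balls. It holds for bounded quadratic
    forms and for the potentials, is stable under sums and linear contractions, and yields the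
    Lipschitz bound and the chain rule used for the energy. *)
Record smooth (V : lmodType R) (X : nspace V) (F : V -> R) (dF : V -> V -> R)
    : Prop := Smooth {
  sm_linear : forall x, carrier X x ->
    linear_on (W := R^o) (carrier X) (dF x) ;
  sm_bounded : forall rho : R, exists2 M : R, 0 <= M & forall x w,
    carrier X x -> carrier X w -> nrm X x <= rho -> `|dF x w| <= M * nrm X w ;
  sm_diff : forall x, carrier X x -> forall e : R, 0 < e ->
    exists2 d : R, 0 < d & forall w, carrier X w -> nrm X w < d ->
      `|F (x + w) - F x - dF x w| <= e * nrm X w }.

Section Theory.
Context {V : lmodType R} (X : nspace V) (sX : seminormed X).

(** The first-order remainder is exactly [q w w / 2]. *)
Lemma smooth_quadratic (q : V -> V -> R) M :
  (forall x, carrier X x -> linear_on (W := R^o) (carrier X) (q x)) ->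
  (forall x y, carrier X x -> carrier X y -> q x y = q y x) ->
  (forall x y, carrier X x -> carrier X y -> `|q x y| <= M * nrm X x * nrm X y) ->
  smooth X (fun x => q x x / 2) q.
Proof.
move=> qL qC qM.
have {}qM x y : carrier X x -> carrier X y -> `|q x y| <= `|M| * nrm X x * nrm X y.
  move=> Xx Xy; rewrite (le_trans (qM x y Xx Xy))// ler_wpM2r ?(sn_ge0 sX)//.
  by rewrite ler_wpM2r ?(sn_ge0 sX)// ler_norm.
have qDr x y z : carrier X x -> carrier X y -> carrier X z ->
    q x (y + z) = q x y + q x z.
  by move=> Xx Xy Xz; rewrite (linear_onD (qL _ Xx)).
have qDl x y z : carrier X x -> carrier X y -> carrier X z ->
    q (x + y) z = q x z + q y z.
  move=> Xx Xy Xz; have Xxy := sn_cD sX Xx Xy.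
  by rewrite qC// qDr// qC// (qC z).
have expand x w : carrier X x -> carrier X w ->
    q (x + w) (x + w) = q x x + 2 * q x w + q w w.
  move=> Xx Xw; have Xxw := sn_cD sX Xx Xw.
  by rewrite qDr// !qDl// (qC w x)//; ring.
split=> //.
- move=> rho; exists (`|M| * `|rho|) => [|x w Xx Xw xr]; first exact: mulr_ge0.
  rewrite (le_trans (qM _ _ Xx Xw))// ler_wpM2r ?(sn_ge0 sX)// ler_wpM2l//.
  exact: le_trans (ler_norm _).
- move=> x Xx e e0.
  have M1 : 0 < `|M| + 1 by rewrite ltr_wpDl.
  exists (e / (`|M| + 1)) => [|w Xw we]; first by rewrite divr_gt0.
  rewrite expand// (_ : _ - _ = q w w / 2); last by field.
  rewrite normrM (@ger0_norm _ 2^-1)//.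
  have h := qM _ _ Xw Xw.
  have n0 := sn_ge0 sX w.
  have : (`|M| + 1) * nrm X w <= e by rewrite mulrC -ler_pdivlMr// ltW.
  move=> /(ler_wpM2r n0).
  have : 0 <= nrm X w * nrm X w by rewrite mulr_ge0.
  have : 0 <= `|M| * nrm X w * nrm X w by rewrite !mulr_ge0.
  lra.
Qed.

Lemma smoothD F dF G dG : smooth X F dF -> smooth X G dG ->
  smooth X (fun x => F x + G x) (fun x w => dF x w + dG x w).
Proof.
case=> FL Fb Fd [GL Gb Gd]; split.
- move=> x Xx a y z Xy Xz; rewrite FL// GL// /GRing.scale/=; ring.
- move=> rho; have [M M0 hM] := Fb rho; have [M' M'0 hM'] := Gb rho.
  exists (M + M') => [|x w Xx Xw xr]; first exact: addr_ge0.
  by rewrite mulrDl (le_trans (ler_normD _ _))//; apply: lerD; [exact: hM|exact: hM'].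
- move=> x Xx e e0; have e20 : 0 < e / 2 by rewrite divr_gt0.
  have [d d0 hd] := Fd x Xx _ e20; have [d' d'0 hd'] := Gd x Xx _ e20.
  exists (Num.min d d'); first by rewrite lt_min d0.
  move=> w Xw; rewrite lt_min => /andP[wd wd'].
  have h1 := hd w Xw wd; have h2 := hd' w Xw wd'.
  rewrite [X in `|X|](_ : _ = (F (x + w) - F x - dF x w) +
    (G (x + w) - G x - dG x w)); last by ring.
  rewrite (le_trans (ler_normD _ _))//; lra.
Qed.

Lemma smooth_comp (W : lmodType R) (Z : nspace W) (p : V -> W) F dF :
  linear_on (carrier X) p ->
  (forall x, carrier X x -> carrier Z (p x) /\ nrm Z (p x) <= nrm X x) ->
  smooth Z F dF -> smooth X (F \o p) (fun x w => dF (p x) (p w)).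
Proof.
move=> pL pZ [FL Fb Fd].
have pc x : carrier X x -> carrier Z (p x) by move=> /pZ[].
have pn x : carrier X x -> nrm Z (p x) <= nrm X x by move=> /pZ[].
split.
- by move=> x Xx a y z Xy Xz; rewrite pL// FL//; exact: pc.
- move=> rho; have [M M0 hM] := Fb rho; exists M => // x w Xx Xw xr.
  rewrite (le_trans (hM _ _ (pc _ Xx) (pc _ Xw) _))//.
    exact: le_trans (pn _ Xx) xr.
  by rewrite ler_wpM2l// pn.
- move=> x Xx e e0; have [d d0 hd] := Fd _ (pc _ Xx) e e0.
  exists d => // w Xw wd /=; rewrite (linear_onD pL)//.
  rewrite (le_trans (hd _ (pc _ Xw) _))//; first exact: le_lt_trans (pn _ Xw) wd.
  by rewrite ler_wpM2l ?pn// ltW.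
Qed.

Definition diff_at (a b : R) (y : R -> V) (t : R) (z : V) :=
  forall e : R, 0 < e -> exists2 d : R, 0 < d & forall s, `|s - t| < d ->
    a <= s <= b -> nrm X (y s - y t - (s - t) *: z) <= e * `|s - t|.

(** Half of e pays for the remainder of F, half for the derivative of F applied to the remainder of
    y. *)
Lemma smooth_chain F dF (a b : R) (y : R -> V) t z :
  smooth X F dF -> (forall s, a <= s <= b -> carrier X (y s)) -> a <= t <= b ->
  carrier X z -> diff_at a b y t z ->
  forall e : R, 0 < e -> upper_slope_le (F \o y) a b t (dF (y t) z + e).
Proof.
move=> [FL Fb Fd] Xy tab Xz yz e e0.
have Xyt := Xy t tab.
have [M M0 {}Fb] := Fb (nrm X (y t)).
have hM w : carrier X w -> `|dF (y t) w| <= M * nrm X w.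
  by move=> Xw; exact: Fb.
have n0 := sn_ge0 sX z.
have e10 : 0 < e / (2 * (nrm X z + 1)) by rewrite divr_gt0// mulr_gt0// ltr_wpDl.
have [d1 d10 hd1] := Fd _ Xyt _ e10.
(* The bound by 1 makes the increment of y at most (|z| + 1) |s - t|, whatever e is. *)
have e20 : 0 < Num.min 1 (e / (2 * (M + 1))).
  by rewrite lt_min ltr01 divr_gt0// mulr_gt0// ltr_wpDl.
have [d2 d20 hd2] := yz _ e20.
exists (Num.min d2 (d1 / (nrm X z + 1))).
  by rewrite lt_min d20 divr_gt0// ltr_wpDl.
move=> s; rewrite lt_min => /andP[sd2 sd1] sab.
have Xys := Xy s sab.
have := hd2 s sd2 sab.
set w := y s - y t => hw.
have Xw : carrier X w by exact: sn_cB.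
have Xtz : carrier X ((s - t) *: z) by exact: sn_cZ.
have h1 : nrm X w <= (nrm X z + 1) * `|s - t|.
  have := sn_D sX (sn_cB sX Xw Xtz) Xtz; rewrite subrK (sn_Z sX)// => h.
  have : Num.min 1 (e / (2 * (M + 1))) * `|s - t| <= 1 * `|s - t|.
    by rewrite ler_wpM2r// ge_min lexx.
  lra.
have h2 : `|F (y s) - F (y t) - dF (y t) w| <= e / (2 * (nrm X z + 1)) * nrm X w.
  have yw : y t + w = y s by rewrite /w addrC subrK.
  have := hd1 w Xw; rewrite yw; apply.
  by rewrite (le_lt_trans h1)// mulrC -ltr_pdivlMr// ltr_wpDl.
have h3 : `|dF (y t) (w - (s - t) *: z)| <= e / 2 * `|s - t|.
  rewrite (le_trans (hM _ (sn_cB sX Xw Xtz)))//.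
  rewrite (le_trans (ler_wpM2l M0 hw))// mulrA ler_wpM2r//.
  have hm : Num.min 1 (e / (2 * (M + 1))) <= e / (2 * (M + 1)) by rewrite ge_min lexx orbT.
  rewrite (le_trans (ler_wpM2l M0 hm))// mulrA ler_pdivrMr ?mulr_gt0 ?ltr_wpDl//.
  rewrite (_ : e / 2 * (2 * (M + 1)) = M * e + e); last by field.
  by rewrite lerDl ltW.
have h4 : `|F (y s) - F (y t) - dF (y t) w| <= e / 2 * `|s - t|.
  rewrite (le_trans h2)// (le_trans (ler_wpM2l (ltW e10) h1))//.
  rewrite mulrA ler_wpM2r// (_ : e / _ * _ = e / 2)//; field.
  by rewrite gt_eqF// ltr_wpDl.
have h5 : dF (y t) (w - (s - t) *: z) = dF (y t) w - (s - t) * dF (y t) z.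
  by rewrite (linear_onB (FL _ Xyt))// (linear_onZ _ (sn_sub sX) (FL _ Xyt)).
rewrite h5 in h3.
have h6 : `|F (y s) - F (y t) - (s - t) * dF (y t) z| <= e * `|s - t|.
  rewrite [X in `|X|](_ : _ = (F (y s) - F (y t) - dF (y t) w) +
    (dF (y t) w - (s - t) * dF (y t) z)); last by ring.
  rewrite (le_trans (ler_normD _ _))//; lra.
rewrite -subr_ge0 [leRHS](_ : _ = e * `|s - t| ^+ 2 -
  (s - t) * (F (y s) - F (y t) - (s - t) * dF (y t) z)); last first.
  by rewrite real_normK ?num_real//=; ring.
rewrite subr_ge0 (le_trans (ler_norm _))// normrM expr2 mulrCA.
by rewrite ler_wpM2l.
Qed.

(** Mean value inequality along the segment from y to x, which stays in the ball by convexity. *)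
Lemma smooth_lipschitz F dF rho : smooth X F dF ->
  exists2 L : R, 0 <= L & forall x y, carrier X x -> carrier X y ->
    nrm X x <= rho -> nrm X y <= rho -> `|F x - F y| <= L * nrm X (x - y).
Proof.
move=> smF; have [M M0 hM] := sm_bounded smF rho; exists M => //.
have half x y : carrier X x -> carrier X y -> nrm X x <= rho -> nrm X y <= rho ->
    F x - F y <= M * nrm X (x - y).
  move=> Xx Xy xr yr.
  have Xw := sn_cB sX Xx Xy.
  pose p (s : R) := y + s *: (x - y).
  have Xp s : carrier X (p s) by apply: (sn_cD sX) => //; exact: sn_cZ.
  have := @upper_slope_le_mvt R 0 1 (M * nrm X (x - y)) (F \o p) ler01.
  rewrite /= /p scale1r scale0r addr0 subr0 mulr1 [y + (x - y)]addrC subrK; apply.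
  move=> t e t01 e0.
  have [|d d0 hd] := smooth_chain smF (fun s _ => Xp s) t01 Xw _ e0.
    move=> e1 e10; exists 1 => // s _ _.
    have -> : p s - p t - (s - t) *: (x - y) = 0.
      by rewrite /p opprD addrACA subrr add0r -scalerBl subrr.
    by rewrite (sn_n0 sX) mulr_ge0// ltW.
  exists d => // s sd s01; rewrite (le_trans (hd s sd s01))//.
  rewrite ler_wpM2r ?sqr_ge0// lerD2r (le_trans (ler_norm _))// hM//.
  rewrite (_ : p t = (1 - t) *: y + t *: x); last first.
    by rewrite /p scalerBl scale1r scalerBr addrAC -addrA.
  rewrite (le_trans (sn_D sX (sn_cZ sX _ Xy) (sn_cZ sX _ Xx)))//.
  case/andP: t01 => t0 t1; rewrite !(sn_Z sX)// (ger0_norm t0) ger0_norm ?subr_ge0//.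
  have h1 : (1 - t) * nrm X y <= (1 - t) * rho by rewrite ler_wpM2l ?subr_ge0.
  have h2 := ler_wpM2l t0 xr.
  lra.
move=> x y Xx Xy xr yr; rewrite ler_norml half// andbT lerNl opprB.
by rewrite (sn_distC sX)// half.
Qed.

Lemma cont_on_bounded (a b : R) (y : R -> V) : a <= b ->
  (forall s, a <= s <= b -> carrier X (y s)) ->
  (forall t, a <= t <= b -> exists2 d : R, 0 < d & forall s, `|s - t| < d ->
     a <= s <= b -> nrm X (y s - y t) <= 1) ->
  exists rho : R, forall t, a <= t <= b -> nrm X (y t) <= rho.
Proof.
move=> ab Xy yc.
have [rho hrho] : exists rho : R, forall t,
   a <= t <= b -> a <= t <= b -> nrm X (y t) <= rho.
  apply: (@cousin _ a b (fun c d => exists rho : R, forall t,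
    a <= t <= b -> c <= t <= d -> nrm X (y t) <= rho)) => //.
    move=> c d e [r1 h1] [r2 h2]; exists (Num.max r1 r2) => t tab /andP[ct te].
    rewrite le_max; have [td|dt] := leP t d.
      by rewrite h1// ct.
    by rewrite orbC h2// te ltW.
  move=> x xab; have [d d0 hd] := yc x xab.
  exists d => // c e cx xe xc ex; exists (1 + nrm X (y x)) => t tab /andP[ct te].
  have := sn_D sX (sn_cB sX (Xy t tab) (Xy x xab)) (Xy x xab); rewrite subrK.
  move=> /le_trans; apply; rewrite lerD2r hd//.
  by rewrite ltr_distlC; apply/andP; split; lra.
by exists rho => t tab; exact: hrho.
Qed.

(** F is Lipschitz on a ball that contains the path, so F along the path inherits absolute
    continuity; the chain rule supplies its slope almost everywhere. *)
Lemma smooth_path_le F dF (a b m : R) (y : R -> V) :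
  smooth X F dF -> a <= b -> (forall s, a <= s <= b -> carrier X (y s)) ->
  (exists rho : R, forall t, a <= t <= b -> nrm X (y t) <= rho) ->
  ac_incr a b (fun l r => nrm X (y r - y l)) ->
  {ae lebesgue_measure, forall t : R, a < t < b ->
     exists2 z, carrier X z /\ diff_at a b y t z & dF (y t) z <= m} ->
  F (y b) - F (y a) <= m * (b - a).
Proof.
move=> smF ab Xy [rho yr] yac yd.
have [L L0 hL] := smooth_lipschitz rho smF.
apply: (@ac_incr_ae_derive_le _ a b m (F \o y)) => //.
  apply: (ac_incr_le (M := L) yac) => l r al lr rb; split.
    exact: (sn_ge0 sX).
  have lab : a <= l <= b by rewrite al (le_trans lr).
  have rab : a <= r <= b by rewrite rb (le_trans al).
  by apply: hL; [exact: Xy|exact: Xy|exact: yr|exact: yr].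
apply: lebesgue_ae_impl yd => t + tab => /(_ tab)[z [Xz yz] dm] e e0.
have tab' : a <= t <= b by case/andP: tab => /ltW -> /ltW ->.
have [d d0 hd] := smooth_chain smF Xy tab' Xz yz e0.
exists d => // s sd sab; rewrite (le_trans (hd s sd sab))//.
by rewrite ler_wpM2r ?sqr_ge0// lerD2r.
Qed.

End Theory.
End SmoothFunctionals.

(** * The phase space *)

Section PhaseSpace.
Context {R : realType} {H : completeNormedModType R} (ip : {dot H for idfun}).
Hypothesis ip_norm : forall x, ip x x = `|x| ^+ 2.
Variables (S : pop H) (c : R).
Hypotheses (saS : self_adjoint ip S) (c_gt0 : 0 < c)
  (S_low : forall u, pdom S u -> `|u| <= c * `|S u|).
Local Notation HH := (H * H)%type.

Local Notation X12 := (Hbar12 S).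
Local Notation X0 := (Hbar ip).
Local Notation Xp := (phase ip S).

Definition diagS (U : HH) : HH := (S U.1, S U.2).

Lemma nrm_Hbar12E U : nrm X12 U = nrm X0 (diagS U).
Proof. by rewrite /= /ipb !ip_norm. Qed.

Lemma lin_subspace_Hbar12 : lin_subspace (carrier X12).
Proof.
case: saS => [[S0 SP] _ _ _ _]; split => // a U W [U1 U2] [W1 W2].
by split; apply: SP.
Qed.

Lemma linear_on_diagS : linear_on (carrier X12) diagS.
Proof.
case: saS => [_ SL _ _ _] a U W [U1 U2] [W1 W2].
by rewrite /diagS /= !SL.
Qed.

Lemma seminormed_H12 : seminormed (H12 S).
Proof.
case: saS => [SS SL _ _ _].
apply: (@seminormed_form _ _ _ (H12 S) S ip) => //; first exact: ipC.
- exact: ipP.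
- exact: ip_ge0.
move=> u; by rewrite ip_norm sqrtr_sqr normr_id.
Qed.

Lemma seminormed_Hbar12 : seminormed X12.
Proof.
exact: seminormed_form (ipbC ip) (ipbP ip) (ipb_ge0 ip_norm)
  lin_subspace_Hbar12 linear_on_diagS nrm_Hbar12E.
Qed.

Definition ipp (Y Z : HH * HH) := ipb ip Y.1 Z.1 + ipb ip Y.2 Z.2.

Lemma seminormed_phase : seminormed Xp.
Proof.
apply: (@seminormed_form _ _ _ _ (fun Y => (diagS Y.1, Y.2)) ipp).
- by move=> Y Z; rewrite /ipp ipbC (ipbC _ Y.2).
- by move=> a Y Z T; rewrite /ipp /= !ipbP; ring.
- by move=> Y; rewrite addr_ge0 ?ipb_ge0.
- case: lin_subspace_Hbar12 => h0 hP; split => // a Y Z hY hZ; exact: hP.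
- by move=> a Y Z hY hZ /=; rewrite linear_on_diagS.
- move=> Y; have -> : nrm Xp Y = Num.sqrt (nrm X12 Y.1 ^+ 2 + nrm X0 Y.2 ^+ 2) by [].
  by rewrite nrm_Hbar12E -!(ipb_nrm ip_norm).
Qed.

Lemma nrm_Hbar_ge0 U : 0 <= nrm X0 U. Proof. exact: sqrtr_ge0. Qed.
Lemma nrm_Hbar12_ge0 U : 0 <= nrm X12 U. Proof. exact: sqrtr_ge0. Qed.
Lemma nrm_phase_ge0 Y : 0 <= nrm Xp Y. Proof. exact: sqrtr_ge0. Qed.

Lemma nrm_Hbar_sqr U : nrm X0 U ^+ 2 = `|U.1| ^+ 2 + `|U.2| ^+ 2.
Proof. by rewrite -(ipb_nrm ip_norm) /ipb !ip_norm. Qed.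

Lemma nrm_Hbar_eq0 U : nrm X0 U = 0 -> U = 0.
Proof.
move=> U0; have := nrm_Hbar_sqr U; rewrite U0 expr0n/= => /esym/eqP.
rewrite paddr_eq0 ?sqr_ge0// !sqrf_eq0 !normr_eq0 => /andP[/eqP h1 /eqP h2].
by rewrite (surjective_pairing U) h1 h2.
Qed.

Lemma nrm_Hbar12_sqr U : nrm X12 U ^+ 2 = `|S U.1| ^+ 2 + `|S U.2| ^+ 2.
Proof. by rewrite nrm_Hbar12E nrm_Hbar_sqr. Qed.

Lemma nrm_phase_sqr Y : nrm Xp Y ^+ 2 = nrm X12 Y.1 ^+ 2 + nrm X0 Y.2 ^+ 2.
Proof. by rewrite [nrm Xp Y]/= sqr_sqrtr// addr_ge0 ?sqr_ge0. Qed.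

Lemma ler_sqrD1 (x y z : R) : 0 <= y -> y ^+ 2 = x ^+ 2 + z ^+ 2 -> x <= y.
Proof.
move=> y0 e; have [x0|x0] := leP x 0; first exact: le_trans x0 y0.
have {}x0 := ltW x0.
by rewrite -(@ler_pXn2r _ 2)// ?nnegrE// e lerDl sqr_ge0.
Qed.

Lemma ler_sqrDD (x y z : R) : 0 <= x -> 0 <= z -> 0 <= y ->
  y ^+ 2 = x ^+ 2 + z ^+ 2 -> y <= x + z.
Proof.
move=> x0 z0 y0 e.
by rewrite -(@ler_pXn2r _ 2)// ?nnegrE// ?addr_ge0// sqrrD e lerD2r lerDl mulrn_wge0// mulr_ge0.
Qed.

Lemma nrm_phase1 Y : nrm X12 Y.1 <= nrm Xp Y.
Proof. exact: ler_sqrD1 (nrm_phase_ge0 _) (nrm_phase_sqr _). Qed.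

Lemma nrm_phase2 Y : nrm X0 Y.2 <= nrm Xp Y.
Proof.
by apply: (ler_sqrD1 (nrm_phase_ge0 Y)); rewrite addrC; exact: nrm_phase_sqr.
Qed.

Lemma nrm_phase_le Y : nrm Xp Y <= nrm X12 Y.1 + nrm X0 Y.2.
Proof.
exact: ler_sqrDD (nrm_Hbar12_ge0 _) (nrm_Hbar_ge0 _) (nrm_phase_ge0 _) (nrm_phase_sqr _).
Qed.

Lemma nrm_H12_1 U : `|S U.1| <= nrm X12 U.
Proof. exact: ler_sqrD1 (nrm_Hbar12_ge0 _) (nrm_Hbar12_sqr _). Qed.

Lemma nrm_H12_2 U : `|S U.2| <= nrm X12 U.
Proof.
by apply: (ler_sqrD1 (nrm_Hbar12_ge0 U)); rewrite addrC; exact: nrm_Hbar12_sqr.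
Qed.

Lemma nrm_Hbar12_le U : nrm X12 U <= `|S U.1| + `|S U.2|.
Proof. exact: ler_sqrDD (nrm_Hbar12_ge0 _) (nrm_Hbar12_sqr _). Qed.

Lemma nrm_Hbar_le U : carrier X12 U -> nrm X0 U <= c * nrm X12 U.
Proof.
move=> [U1 U2].
have c0 := ltW c_gt0.
rewrite -(@ler_pXn2r _ 2)// ?nnegrE ?mulr_ge0 ?nrm_Hbar_ge0 ?nrm_Hbar12_ge0//.
rewrite exprMn nrm_Hbar_sqr nrm_Hbar12_sqr mulrDr -!exprMn.
by apply: lerD; rewrite ler_pXn2r ?nnegrE ?mulr_ge0// S_low.
Qed.

(** By [S_low] a Cauchy sequence converges in H, its image under S converges too, and the graph of S
    is closed. *)
Lemma complete_H12 : complete_ns (H12 S).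
Proof.
case: (saS) => sub lin _ _ _ u_ du cu.
have [n d|y ylim] := complete_seq (y_ := S \o u_).
  have [N hN] := cu n d; exists N => m k Nm Nk /=.
  by rewrite -(linear_onB lin (du m) (du k)); exact: hN.
have [n d|x xlim] := complete_seq (y_ := u_).
  have [N hN] := cu _ (divr_gt0 d c_gt0); exists N => m k Nm Nk /=.
  rewrite (le_trans (S_low _))//.
    by apply: (sn_cB seminormed_H12); exact: du.
  by rewrite mulrC -ler_pdivlMr//; exact: hN.
have [dx Sx] : pdom S x /\ S x = y.
  apply: (self_adjoint_closed ip_norm saS) => e e0.
  have [N hN] := xlim e e0; have [M hM] := ylim e e0.
  exists (u_ (maxn N M)); split; [exact: du|apply: hN|apply: hM].
  + exact: leq_maxl.
  + exact: leq_maxr.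
exists x => // e e0; have [N hN] := ylim e e0; exists N => n Nn /=.
by rewrite (linear_onB lin dx (du n)) Sx; exact: hN.
Qed.

Lemma complete_Hbar12 : complete_ns X12.
Proof.
move=> U_ dU cU.
have [n|e e0|u1 du1 lim1] := complete_H12 (x_ := fun n => (U_ n).1).
- by case: (dU n).
- have [N hN] := cU e e0; exists N => m n Nm Nn.
  exact: le_trans (nrm_H12_1 (U_ m - U_ n)) (hN _ _ Nm Nn).
have [n|e e0|u2 du2 lim2] := complete_H12 (x_ := fun n => (U_ n).2).
- by case: (dU n).
- have [N hN] := cU e e0; exists N => m n Nm Nn.
  exact: le_trans (nrm_H12_2 (U_ m - U_ n)) (hN _ _ Nm Nn).
exists (u1, u2) => // e e0; have e20 : 0 < e / 2 by rewrite divr_gt0.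
have [N hN] := lim1 _ e20; have [M hM] := lim2 _ e20.
exists (maxn N M) => n; rewrite geq_max => /andP[Nn Mn].
rewrite (le_trans (nrm_Hbar12_le _))// [leRHS]splitr.
by apply: lerD; [exact: hN|exact: hM].
Qed.

(* Uniform boundedness for the functionals U |-> (K U, W) with |W| <= 1, each of
   which is continuous because K is symmetric. *)
Lemma sym_form_bounded (K : HH -> HH) : linear_on (carrier X12) K ->
  (forall U W, carrier X12 U -> carrier X12 W ->
     ipb ip (K U) W = ipb ip (K W) U) ->
  exists2 M, 0 <= M & forall U W, carrier X12 U -> carrier X12 W ->
    `|ipb ip (K U) W| <= M * nrm X12 U * nrm X0 W.
Proof.
move=> KL KC.
have s12 := seminormed_Hbar12.
pose I := {W : HH | carrier X12 W /\ nrm X0 W <= 1}.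
pose f (i : I) U := ipb ip (K U) (sval i).
have [|||M hM] := @uniform_boundedness _ _ X12 s12 I f complete_Hbar12.
- by move=> [W [dW W1]] a U Z dU dZ; rewrite /f /= KL// ipbP.
- move=> [W [dW W1]]; exists (nrm X0 (K W) * c) => U dU.
  rewrite /f /= KC// (le_trans (ipb_CS ip_norm _ _))// -mulrA.
  by rewrite ler_wpM2l ?nrm_Hbar_ge0//; exact: nrm_Hbar_le.
- move=> U dU; exists (nrm X0 (K U)) => -[W [dW W1]].
  rewrite /f /= (le_trans (ipb_CS ip_norm _ _))// -[leRHS]mulr1.
  by rewrite ler_wpM2l ?nrm_Hbar_ge0.
exists `|M| => // U W dU dW.
have [W0|W0] := eqVneq (nrm X0 W) 0.
  by have := ipb_CS ip_norm (K U) W; rewrite W0 !mulr0.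
have Wgt0 : 0 < nrm X0 W by rewrite lt_neqAle eq_sym W0 nrm_Hbar_ge0.
rewrite -ler_pdivrMr//.
have h : carrier X12 ((nrm X0 W)^-1 *: W) /\ nrm X0 ((nrm X0 W)^-1 *: W) <= 1.
  split; first exact: (sn_cZ s12).
  rewrite (sn_Z (seminormed_Hbar ip_norm))// normfV ger0_norm ?nrm_Hbar_ge0//.
  by rewrite mulVf.
have := hM (exist _ _ h) U dU.
rewrite /f /= ipbC ipbZl// normrM normfV (ger0_norm (nrm_Hbar_ge0 _)) ipbC mulrC.
by move=> /le_trans; apply; rewrite ler_wpM2r ?nrm_Hbar12_ge0// ler_norm.
Qed.

(** The Lipschitz property around 0 bounds B on balls, and [S_low] turns the bound by |w| into one
    by the norm of H^{1/2}. *)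
Lemma potential_smooth (B : H -> H) (P : H -> R) :
  locally_lipschitz_op S B -> is_potential ip S B P ->
  smooth (H12 S) P (fun u w => ip (B u) w).
Proof.
move=> Blip Bpot; split.
- by move=> u _ a y z _ _; rewrite ipPr.
- move=> rho; have r0 : 0 < `|rho| + 1 by rewrite ltr_wpDl.
  have [L hL] := Blip _ r0.
  have d0 := sn0 seminormed_H12; have n0 := sn_n0 seminormed_H12.
  exists ((`|B 0| + `|L| * (`|rho| + 1)) * c).
    by rewrite mulr_ge0 ?(ltW c_gt0)// addr_ge0// mulr_ge0// ltW.
  move=> u w du dw ur; rewrite (le_trans (ip_CS ip_norm _ _))// -mulrA.
  apply: ler_pM => //; last exact: S_low.
  have ur1 : nrm (H12 S) u <= `|rho| + 1.
    by rewrite (le_trans ur)// (le_trans (ler_norm _))// lerDl.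
  have := hL u 0 du d0 ur1; rewrite n0 subr0 => /(_ (ltW r0)) h.
  have h2 : `|B u| <= `|B u - B 0| + `|B 0|.
    by rewrite -{1}[B u](subrK (B 0)) ler_normD.
  have h3 : L * nrm (H12 S) u <= `|L| * (`|rho| + 1).
    rewrite (le_trans (ler_wpM2r _ (ler_norm L)))//= ler_wpM2l//.
  lra.
- move=> u du e e0; have [d d0 hd] := Bpot u du e e0.
  exists d => // w dw wd.
  (* [is_potential] speaks of nonzero norms only; in the other case [S_low] forces w = 0. *)
  have [w0|w0] := eqVneq (nrm (H12 S) w) 0.
    have -> : w = 0.
      apply/eqP; rewrite -normr_le0 (le_trans (S_low dw))//.
      by rewrite [`|S w|]w0 mulr0.
    rewrite addr0 subrr sub0r normrN linear0r normr0.
    exact: mulr_ge0 (ltW e0) (sn_ge0 seminormed_H12 _).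
  have wgt0 : 0 < nrm (H12 S) w by rewrite lt_neqAle eq_sym w0 /=.
  have := hd w dw; rewrite wgt0 wd => /(_ isT).
  by rewrite ler_pdivrMl// mulrC.
Qed.

End PhaseSpace.

(** * Energy inequalities *)

Section Paths.
Context {R : realType} {V : lmodType R}.

Lemma cont_on_eps (X : nspace V) (I : set R) (f : R -> V) t :
  cont_on X I f -> I t -> forall e : R, 0 < e -> exists2 d : R, 0 < d &
    forall s, `|s - t| < d -> I s -> nrm X (f s - f t) <= e.
Proof.
move=> fc It e e0; have [_ /cvgrPdist_le /(_ _ e0)] := fc t It.
move=> /nbhs_ballP[d /= d0 hd]; exists d => // s sd Is.
have ts : ball t d s by rewrite -ball_normE /= distrC.
by have /= := hd s ts Is; rewrite sub0r normrN => /(le_trans (ler_norm _)).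
Qed.

Lemma deriv_in_eps (X : nspace V) (I : set R) (f : R -> V) t y :
  deriv_in X I f t y -> forall e : R, 0 < e -> exists2 d : R, 0 < d &
    forall s, `|s - t| < d -> s != t -> I s ->
      nrm X ((s - t)^-1 *: (f s - f t) - y) <= e.
Proof.
move=> fd e e0; have := fd => /cvgrPdist_le /(_ _ e0).
move=> /nbhs_ballP[d /= d0 hd]; exists d => // s sd st Is.
have ts : ball t d s by rewrite -ball_normE /= distrC.
by have /= := hd s ts st Is; rewrite sub0r normrN => /(le_trans (ler_norm _)).
Qed.

Lemma deriv_in_diff_at (X : nspace V) (I : set R) (a b : R) (f : R -> V) t y :
  seminormed X -> deriv_in X I f t y ->
  (forall s, a <= s <= b -> I s /\ carrier X (f s)) -> a <= t <= b ->
  carrier X y -> diff_at X a b f t y.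
Proof.
move=> sX fd abI tab Xy e e0; have [d d0 hd] := deriv_in_eps fd e0.
exists d => // s sd sab; have [Is Xs] := abI s sab; have [_ Xt] := abI t tab.
have [->|st] := eqVneq s t.
  by rewrite !subrr scale0r subr0 (sn_n0 sX) normr0 mulr0.
have st0 : s - t != 0 by rewrite subr_eq0.
have := hd s sd st Is.
set w := (s - t)^-1 *: _ - y => hw.
have -> : f s - f t - (s - t) *: y = (s - t) *: w.
  by rewrite /w scalerBr scalerA mulfV// scale1r.
have Xw : carrier X w.
  by apply: (sn_cB sX) => //; apply: (sn_cZ sX); exact: (sn_cB sX).
by rewrite (sn_Z sX)// mulrC ler_wpM2r.
Qed.

(** Convergence of the difference quotients in Z implies convergence in X. This identifies U_t, the
    derivative of U in H x H, with its derivative in the square of H^{1/2}. *)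
Lemma deriv_in_unique (X Z : nspace V) (I J : set R) (a b c : R) (f : R -> V) t y z :
  seminormed X -> seminormed Z ->
  (forall x, carrier Z x -> carrier X x /\ nrm X x <= c * nrm Z x) ->
  deriv_in X I f t y -> deriv_in Z J f t z ->
  (forall s, a <= s <= b -> [/\ I s, J s & carrier Z (f s)]) -> a < t < b ->
  carrier X y -> carrier Z z -> nrm X (y - z) = 0.
Proof.
move=> sX sZ ZX fy fz abIJ /andP[at_ tb] Xy Zz.
have tab : a <= t <= b by rewrite !ltW.
apply/eqP; rewrite eq_le (sn_ge0 sX) andbT; apply/ler_addgt0Pr => e e0; rewrite add0r.
have c1 : 0 < `|c| + 1 by rewrite ltr_wpDl.
have e1 : 0 < e / (`|c| + 1) / 2 by rewrite !divr_gt0.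
have [d d0 hd] := deriv_in_eps fy (divr_gt0 e0 (ltr0Sn _ 1)).
have [d' d'0 hd'] := deriv_in_eps fz e1.
pose s := Num.min b (t + Num.min d d' / 2).
have dd : 0 < Num.min d d' by rewrite lt_min d0.
have ts : t < s by rewrite /s lt_min tb ltrDl divr_gt0.
have sb : s <= b by rewrite /s ge_min lexx.
have sdd : `|s - t| < Num.min d d'.
  rewrite gtr0_norm ?subr_gt0// ltrBlDl (@le_lt_trans _ _ (t + Num.min d d' / 2))//.
    by rewrite /s ge_min lexx orbT.
  by rewrite ltrD2l ltr_pdivrMr// ltr_pMr// ltr1n.
move: sdd; rewrite lt_min => /andP[sd sd'].
have [Is Js Zs] := abIJ s (introT andP (conj (le_trans (ltW at_) (ltW ts)) sb)).
have [_ _ Zt] := abIJ t tab.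
have st : s != t by rewrite gt_eqF.
have h1 := hd s sd st Is; have h2 := hd' s sd' st Js.
set q := (s - t)^-1 *: (f s - f t) in h1 h2.
have Zq : carrier Z q by apply: (sn_cZ sZ); exact: (sn_cB sZ).
have [Xq _] := ZX _ Zq; have [Xz _] := ZX _ Zz.
have [_ h3] := ZX _ (sn_cB sZ Zq Zz).
rewrite (le_trans (sn_dist3 sX Xy Xq Xz))// (sn_distC sX)//.
have h4 : c * nrm Z (q - z) <= e / 2.
  have -> : e / 2 = (`|c| + 1) * (e / (`|c| + 1) / 2).
    by field; rewrite gt_eqF.
  apply: (@le_trans _ _ ((`|c| + 1) * nrm Z (q - z))).
    by rewrite ler_wpM2r ?(sn_ge0 sZ)// (le_trans (ler_norm _))// lerDl.
  by rewrite ler_wpM2l// ltW.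
rewrite [leRHS]splitr; apply: lerD => //; exact: le_trans h3 h4.
Qed.

Lemma closed_in_sublevel (X : nspace V) (F : V -> R) (r : R) :
  (forall x, carrier X x -> forall e : R, 0 < e -> exists2 d : R, 0 < d &
     forall y, carrier X y -> nrm X (x - y) <= d -> `|F x - F y| <= e) ->
  closed_in X [set x | carrier X x /\ F x <= r].
Proof.
move=> Fc; split=> [x []//|x Xx xc]; split=> //.
apply/ler_addgt0Pr => e e0.
have [d d0 hd] := Fc x Xx e e0; have [y [Xy Fy] xy] := xc d d0.
have := hd y Xy (ltW xy); have := ler_norm (F x - F y); lra.
Qed.

Lemma closed_in_ball (X : nspace V) (r : R) :
  seminormed X -> closed_in X (ball_of X r).
Proof.
move=> sX; apply: closed_in_sublevel => x Xx e e0; exists e => // y Xy xy.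
have h1 := sn_D sX (sn_cB sX Xx Xy) Xy; rewrite subrK in h1.
have h2 := sn_D sX (sn_cB sX Xy Xx) Xx; rewrite subrK (sn_distC sX)// in h2.
by rewrite ler_norml; apply/andP; split; lra.
Qed.

Lemma smooth_continuous (X : nspace V) F dF : seminormed X -> smooth X F dF ->
  forall x, carrier X x -> forall e : R, 0 < e -> exists2 d : R, 0 < d &
    forall y, carrier X y -> nrm X (x - y) <= d -> `|F x - F y| <= e.
Proof.
move=> sX smF x Xx e e0.
have [L L0 hL] := smooth_lipschitz sX (nrm X x + 1) smF.
have L1 : 0 < L + 1 by rewrite ltr_wpDl.
exists (Num.min 1 (e / (L + 1))); first by rewrite lt_min ltr01 divr_gt0.
move=> y Xy; rewrite le_min => /andP[xy1 xye].
have yr : nrm X y <= nrm X x + 1.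
  have := sn_B sX Xx (sn_cB sX Xx Xy); rewrite subKr; lra.
have xr : nrm X x <= nrm X x + 1 by rewrite lerDl.
rewrite (le_trans (hL x y Xx Xy xr yr))//.
have : nrm X (x - y) * (L + 1) <= e by rewrite -ler_pdivlMr.
have := sn_ge0 sX (x - y); lra.
Qed.

End Paths.

Section Energy.
Context {R : realType} {H : completeNormedModType R} (ip : {dot H for idfun}).
Hypothesis ip_norm : forall x, ip x x = `|x| ^+ 2.
Variables (S : pop H) (c : R).
Hypotheses (saS : self_adjoint ip S) (c_gt0 : 0 < c)
  (S_low : forall u, pdom S u -> `|u| <= c * `|S u|).
Local Notation HH := (H * H)%type.
Local Notation X12 := (Hbar12 S).
Local Notation X0 := (Hbar ip).
Local Notation Xp := (phase ip S).
Variables (nu1 nu2 : R).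
Hypotheses (nu1_gt0 : 0 < nu1) (nu2_gt0 : 0 < nu2).
Variables (D K B : HH -> HH) (P : HH -> R) (kappa : R).
Hypotheses (D_lin : linear_on (carrier X12) D) (K_lin : linear_on (carrier X12) K)
  (D_form : sym_nonneg ip S D) (K_form : sym_nonneg ip S K)
  (P_smooth : smooth X12 P (fun U W => ipb ip (B U) W)).
Local Notation Af := (Aform ip S nu1 nu2).

Let s12 := seminormed_Hbar12 ip_norm saS.
Let s0 := seminormed_Hbar ip_norm.
Let sp := seminormed_phase ip_norm saS.

(** The polarization of twice the quadratic part of W. The value e = 0 gives E and e = eps gives W,
    so one computation serves both. *)
Definition energy_form (e : R) (Y Z : HH * HH) : R :=
  ipb ip Y.2 Z.2 + Af Y.1 Z.1 + kappa * ipb ip (K Y.1) Z.1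
  + e * (ipb ip Y.1 Z.2 + ipb ip Y.2 Z.1 + ipb ip (D Y.1) Z.1).

Definition energy (e : R) (Y : HH * HH) : R :=
  energy_form e Y Y / 2 + P Y.1.

Lemma Aform_le U W :
  `|Af U W| <= (nu1 + nu2) * nrm X12 U * nrm X12 W.
Proof.
rewrite /Aform (le_trans (ler_normD _ _))// !normrM (gtr0_norm nu1_gt0) (gtr0_norm nu2_gt0).
rewrite -mulrA mulrDl; apply: lerD; rewrite ler_pM2l// (le_trans (ip_CS ip_norm _ _))//.
  by apply: ler_pM => //; exact: nrm_H12_1.
by apply: ler_pM => //; exact: nrm_H12_2.
Qed.

Lemma energy_form_linear e Y : carrier Xp Y ->
  linear_on (W := R^o) (carrier Xp) (energy_form e Y).
Proof.
case: saS => _ SL _ _ _.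
move=> dY a Z T [dZ1 dZ2] [dT1 dT2].
rewrite /energy_form /Aform /= !ipbPr !SL// !ipPr /GRing.scale/=; ring.
Qed.

Lemma energy_formC e Y Z : carrier Xp Y -> carrier Xp Z ->
  energy_form e Y Z = energy_form e Z Y.
Proof.
move=> dY dZ; rewrite /energy_form /Aform.
rewrite (D_form.1 Y.1)// (K_form.1 Y.1)// (ipbC ip Y.2 Z.2) (ipC ip (S Y.1.1)).
by rewrite (ipC ip (S Y.1.2)) (ipbC ip Y.1 Z.2) (ipbC ip Y.2 Z.1); ring.
Qed.

(** This constant depends on kappa and, through D, on alpha. It only serves smoothness, hence
    continuity and entry times, never the radius of the absorbing ball. *)
Lemma energy_form_bounded e : exists M, forall Y Z, carrier Xp Y ->
  carrier Xp Z -> `|energy_form e Y Z| <= M * nrm Xp Y * nrm Xp Z.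
Proof.
have [MK MK0 hK] := sym_form_bounded ip_norm saS c_gt0 S_low K_lin K_form.1.
have [MD MD0 hD] := sym_form_bounded ip_norm saS c_gt0 S_low D_lin D_form.1.
exists (1 + (nu1 + nu2) + `|kappa| * (MK * c) + `|e| * (c + c + MD * c)).
move=> Y Z dY dZ.
have Y0 := nrm_phase_ge0 ip S Y; have Z0 := nrm_phase_ge0 ip S Z.
have Y1 := nrm_phase1 ip S Y; have Z1 := nrm_phase1 ip S Z.
have Y2 := nrm_phase2 ip S Y; have Z2 := nrm_phase2 ip S Z.
have Y10 := nrm_Hbar12_ge0 S Y.1; have Z10 := nrm_Hbar12_ge0 S Z.1.
have Y20 := nrm_Hbar_ge0 ip Y.2; have Z20 := nrm_Hbar_ge0 ip Z.2.
have YX U (dU : carrier X12 U.1) : nrm X0 U.1 <= c * nrm Xp U.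
  rewrite (le_trans (nrm_Hbar_le ip_norm c_gt0 S_low dU))// ler_wpM2l ?(ltW c_gt0)//.
  exact: nrm_phase1.
have h1 : `|ipb ip Y.2 Z.2| <= 1 * (nrm Xp Y * nrm Xp Z).
  by rewrite mul1r (le_trans (ipb_CS ip_norm _ _))// ler_pM.
have h2 : `|Af Y.1 Z.1| <= (nu1 + nu2) * (nrm Xp Y * nrm Xp Z).
  rewrite (le_trans (Aform_le _ _))// -mulrA.
  by rewrite ler_wpM2l ?addr_ge0 ?(ltW nu1_gt0) ?(ltW nu2_gt0)//; exact: ler_pM.
have h3 : `|kappa * ipb ip (K Y.1) Z.1| <= `|kappa| * (MK * c) * (nrm Xp Y * nrm Xp Z).
  rewrite normrM -mulrA ler_wpM2l// (le_trans (hK _ _ dY dZ))// -!mulrA ler_wpM2l//.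
  by rewrite mulrCA; apply: ler_pM => //; [exact: nrm_Hbar_ge0|exact: YX].
have h4 : `|ipb ip Y.1 Z.2| <= c * (nrm Xp Y * nrm Xp Z).
  rewrite (le_trans (ipb_CS ip_norm _ _))// mulrA.
  by apply: ler_pM => //; [exact: nrm_Hbar_ge0|exact: YX].
have h5 : `|ipb ip Y.2 Z.1| <= c * (nrm Xp Y * nrm Xp Z).
  rewrite (le_trans (ipb_CS ip_norm _ _))// mulrCA.
  by apply: ler_pM => //; [exact: nrm_Hbar_ge0|exact: YX].
have h6 : `|ipb ip (D Y.1) Z.1| <= MD * c * (nrm Xp Y * nrm Xp Z).
  rewrite (le_trans (hD _ _ dY dZ))// -!mulrA ler_wpM2l//.
  by rewrite mulrCA; apply: ler_pM => //; [exact: nrm_Hbar_ge0|exact: YX].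
have h7 : `|e * (ipb ip Y.1 Z.2 + ipb ip Y.2 Z.1 + ipb ip (D Y.1) Z.1)| <=
    `|e| * (c + c + MD * c) * (nrm Xp Y * nrm Xp Z).
  rewrite normrM -mulrA ler_wpM2l// !mulrDl.
  rewrite (le_trans (ler_normD _ _))// lerD// (le_trans (ler_normD _ _))// lerD//.
rewrite -mulrA mulrDl (le_trans (ler_normD _ _))// lerD//.
rewrite mulrDl (le_trans (ler_normD _ _))// lerD//.
by rewrite mulrDl (le_trans (ler_normD _ _))// lerD.
Qed.

Definition energy_diff (e : R) (Y Z : HH * HH) : R :=
  energy_form e Y Z + ipb ip (B Y.1) Z.1.

Lemma energy_form_smooth e :
  smooth Xp (fun Y => energy_form e Y Y / 2) (energy_form e).
Proof.
have [M hM] := energy_form_bounded e.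
apply: (smooth_quadratic sp (M := M)) => //; first exact: energy_form_linear.
exact: energy_formC.
Qed.

Lemma energy_smooth e : smooth Xp (energy e) (energy_diff e).
Proof.
apply: smoothD; first exact: energy_form_smooth.
have fst_le Y : carrier Xp Y -> carrier X12 Y.1 /\ nrm X12 Y.1 <= nrm Xp Y.
  by split=> //; exact: nrm_phase1.
have fst_lin : linear_on (carrier Xp) (fst : HH * HH -> HH) by [].
exact: smooth_comp fst_lin fst_le P_smooth.
Qed.

(* The e-part uses (U, U_tt) = -(calA U + D U_t + kappa K U + B U, U); the two
   terms (D U_t, U) and (D U, U_t) cancel because D is symmetric. *)
Lemma energy_diff_solution e U V F Z :
  carrier X12 U -> carrier X12 V ->
  represents ip S nu1 nu2 D U V F -> Z + F + kappa *: K U + B U = 0 ->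
  energy_diff e (U, V) (V, Z) = - ipb ip (D V) V +
    e * (ipb ip V V - Af U U - kappa * ipb ip (K U) U - ipb ip (B U) U).
Proof.
move=> dU dV rep eqn.
have ZE Phi : carrier X12 Phi -> ipb ip Z Phi =
    - (Af U Phi + ipb ip (D V) Phi) - kappa * ipb ip (K U) Phi - ipb ip (B U) Phi.
  move=> dPhi; rewrite rep//.
  have : ipb ip (Z + F + kappa *: K U + B U) Phi = 0 by rewrite eqn ipb0l.
  rewrite !ipbDl ipbZl; lra.
rewrite /energy_diff /energy_form /=.
rewrite (ipbC ip V Z) (ipbC ip U Z) !ZE// (D_form.1 U V)//.
rewrite [X in _ + e * X](_ : _ = ipb ip V V - Af U U - kappa * ipb ip (K U) U - ipb ip (B U) U).
  ring.
ring.
Qed.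

(** Almost everywhere the path (U, U_t) has derivative (U_t, U_tt) in the phase space, and the left
    side of the assumed bound is the derivative of [energy e] along it. *)
Lemma strong_energy_le T e m (U Ut : R -> HH) U0 U1 a b :
  strong_solution ip S nu1 nu2 D K B kappa T U Ut U0 U1 ->
  0 < a -> a < b -> b < T ->
  (forall t, a < t < b -> carrier X12 (U t) -> carrier X12 (Ut t) ->
     - ipb ip (D (Ut t)) (Ut t) + e * (ipb ip (Ut t) (Ut t) - Af (U t) (U t)
       - kappa * ipb ip (K (U t)) (U t) - ipb ip (B (U t)) (U t)) <= m) ->
  energy e (U b, Ut b) - energy e (U a, Ut a) <= m * (b - a).
Proof.
move=> [[Uc Ud Utc _ _] UW UtW sol] a0 ab bT hm.
have [Uc' Uac [g [dg gd _]]] := UW a b a0 ab bT.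
have [Utc' Utac _] := UtW a b a0 ab bT.
have inab s : a <= s <= b -> s \in `[a, b] by rewrite in_itv.
have in0T s : a <= s <= b -> s \in `[0, T].
  by move=> /andP[as_ sb]; rewrite in_itv/=; apply/andP; split; lra.
have dU s : a <= s <= b -> carrier X12 (U s) by move=> /inab /Uc' [].
pose y s := (U s, Ut s).
have le_phase V1 V2 V3 V4 : nrm Xp ((V1, V2) - (V3, V4)) <=
    nrm X12 (V1 - V3) + nrm X0 (V2 - V4) by exact: nrm_phase_le.
apply: (smooth_path_le sp (energy_smooth e) (ltW ab) (y := y)).
- by move=> s sab; exact: dU.
- apply: (cont_on_bounded sp (ltW ab)) => [s sab|t tab]; first exact: dU.
  have h2 : 0 < 2^-1 :> R by rewrite invr_gt0.
  have [d d0 hd] := cont_on_eps Uc' (inab t tab) h2.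
  have [d' d'0 hd'] := cont_on_eps Utc' (inab t tab) h2.
  exists (Num.min d d'); first by rewrite lt_min d0.
  move=> s; rewrite lt_min => /andP[sd sd'] sab.
  rewrite (le_trans (le_phase _ _ _ _))// [leRHS](_ : 1 = 2^-1 + 2^-1); last by field.
  by apply: lerD; [apply: hd|apply: hd'] => //; exact: inab.
- apply: (ac_incr_le (M := 1) (ac_incrD (abs_cont_incr Uac) (abs_cont_incr Utac))).
  move=> l r al lr rb; split; last by rewrite mul1r; exact: le_phase.
  by rewrite addr_ge0// sqrtr_ge0.
- apply: lebesgue_ae_impl (lebesgue_ae_and gd sol) => t [gt solt] tab.
  have tab' : a <= t <= b by case/andP: tab => /ltW -> /ltW ->.
  have t0T : t \in `]0, T[ by rewrite in_itv/=; case/andP: tab => *; apply/andP; split; lra.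
  have [dV [F [Z [rep Zd eqn]]]] := solt t0T.
  have {}gt := gt (tab : t \in `]a, b[).
  (* Differentiability of the path in the phase norm needs U_t(t) to be the derivative of U in the
     stronger norm. *)
  have Utg : Ut t = g t.
    apply/eqP; rewrite -subr_eq0; apply/eqP; apply: (nrm_Hbar_eq0 ip_norm).
    apply: (deriv_in_unique s0 s12 (c := c) _ (Ud t (in0T t tab')) gt _ tab) => //.
      by move=> U3 dU3; split=> //; exact: nrm_Hbar_le.
    by move=> s sab; split; [exact: in0T|exact: inab|exact: dU].
  exists (Ut t, Z).
    split=> // d d0; have d20 : 0 < d / 2 by rewrite divr_gt0.
    rewrite -Utg in gt.
    have hI s : a <= s <= b -> `[a, b]%classic s /\ carrier X12 (U s).
      by move=> sab; split; [exact: inab|exact: dU].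
    have hJ s : a <= s <= b -> `[0, T]%classic s /\ carrier X0 (Ut s).
      by move=> sab; split=> //; exact: in0T.
    have [d1 d10 hd1] := deriv_in_diff_at s12 gt hI tab' dV d20.
    have [d2 d2_0 hd2] := deriv_in_diff_at s0 Zd hJ tab' (Logic.I : carrier X0 Z) d20.
    exists (Num.min d1 d2); first by rewrite lt_min d10.
    move=> s; rewrite lt_min => /andP[sd1 sd2] sab.
    rewrite (le_trans (nrm_phase_le _ _ _))// [d in leRHS]splitr mulrDl.
    by apply: lerD; [exact: hd1|exact: hd2].
  have := hm t tab (dU t tab') dV.
  by rewrite -(energy_diff_solution e (dU t tab') dV rep eqn).
Qed.

(** Generalized solutions are limits in the norm of calA^{1/2}; this brings the convergence to the
    phase space. *)
Lemma nrm_Hbar12_Aform U :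
  nrm X12 U <= Num.sqrt (Num.min nu1 nu2)^-1 * Num.sqrt (Af U U).
Proof.
have nu0 : 0 < Num.min nu1 nu2 by rewrite lt_min nu1_gt0.
rewrite -sqrtrM ?invr_ge0 ?(ltW nu0)//.
rewrite -[leLHS]ger0_norm ?nrm_Hbar12_ge0// -sqrtr_sqr ler_wsqrtr//.
rewrite (nrm_Hbar12_sqr ip_norm) ler_pdivlMl// mulrDr /Aform !ip_norm.
by apply: lerD; rewrite ler_wpM2r ?sqr_ge0// ge_min lexx ?orbT.
Qed.

Section Dissipation.
Variables (e k C2 : R).
Hypotheses (k_ge0 : 0 <= k)
  (dissip : forall U V, carrier X12 U -> carrier X12 V ->
     - ipb ip (D V) V + e * (ipb ip V V - Af U U - kappa * ipb ip (K U) U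
       - ipb ip (B U) U) <= - (k * (energy 0 (U, V) - C2))).

(** The energy with e = 0 decreases, so E(t) >= E(b) on ]a, b[ and [dissip] bounds the slope of W by
    the constant - k (E(b) - C2). *)
Lemma strong_dissipation T (U Ut : R -> HH) U0 U1 a b :
  strong_solution ip S nu1 nu2 D K B kappa T U Ut U0 U1 ->
  0 < a -> a < b -> b < T ->
  energy e (U b, Ut b) + k * (energy 0 (U b, Ut b) - C2) * (b - a)
    <= energy e (U a, Ut a).
Proof.
move=> sol a0 ab bT.
have decr t : a < t < b -> energy 0 (U b, Ut b) <= energy 0 (U t, Ut t).
  move=> /andP[at_ tb].
  have := strong_energy_le (e := 0) (m := 0) sol (lt_trans a0 at_) tb bT.
  rewrite mul0r subr_le0; apply => s _ _ dV.
  by rewrite mul0r addr0 oppr_le0; apply: D_form.2.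
have := strong_energy_le (e := e) (m := - (k * (energy 0 (U b, Ut b) - C2))) sol a0 ab bT.
rewrite mulNr lerBlDl lerBrDr; apply=> t tab dU dV.
rewrite (le_trans (dissip dU dV))// lerN2 ler_wpM2l// lerD2r; exact: decr.
Qed.

Lemma generalized_dissipation T (U Ut : R -> HH) U0 U1 a b :
  generalized_solution ip S nu1 nu2 D K B kappa T U Ut U0 U1 ->
  0 < a -> a < b -> b < T ->
  energy e (U b, Ut b) + k * (energy 0 (U b, Ut b) - C2) * (b - a)
    <= energy e (U a, Ut a).
Proof.
move=> [[Uc _ _ _ _] [Un [Utn [sol appr]]]] a0 ab bT.
have in0T s : a <= s <= b -> s \in `[0, T].
  by move=> /andP[as_ sb]; rewrite in_itv/=; apply/andP; split; lra.
have aab : a <= a <= b by rewrite lexx ltW.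
have bab : a <= b <= b by rewrite lexx ltW.
apply/ler_addgt0Pr => r r0.
have kba : 0 <= k * (b - a) by rewrite mulr_ge0// subr_ge0 ltW.
(* Three errors of size tau occur: W at a, W at b, and E at b, the last multiplied by k (b - a). *)
pose tau := r / (2 + k * (b - a)).
have tau0 : 0 < tau by rewrite divr_gt0// ltr_wpDr.
have dU s : a <= s <= b -> carrier Xp (U s, Ut s) by move=> /in0T /Uc [].
have dUn n s : a <= s <= b -> carrier Xp (Un n s, Utn n s).
  by have [[Unc _ _ _ _] _ _ _] := sol n; move=> /in0T /Unc [].
have [d1 d10 h1] := smooth_continuous sp (energy_smooth e) (dU b bab) tau0.
have [d2 d20 h2] := smooth_continuous sp (energy_smooth 0) (dU b bab) tau0.
have [d3 d30 h3] := smooth_continuous sp (energy_smooth e) (dU a aab) tau0.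
pose q := Num.sqrt (Num.min nu1 nu2)^-1.
have q0 : 0 <= q by exact: sqrtr_ge0.
have q1 : 0 < q + 1 by rewrite ltr_wpDl.
pose d := Num.min d1 (Num.min d2 d3).
have d0 : 0 < d by rewrite !lt_min d10 d20.
have [N _ hN] := appr _ (divr_gt0 d0 q1).
have {}hN s : a <= s <= b -> nrm Xp ((U s, Ut s) - (Un N s, Utn N s)) <= d.
  move=> sab; have h := hN N (leqnn N) s (in0T s sab).
  rewrite ler_pdivlMr// in h.
  have h' : nrm Xp ((U s, Ut s) - (Un N s, Utn N s)) <=
      nrm X12 (U s - Un N s) + nrm X0 (Ut s - Utn N s) by exact: nrm_phase_le.
  have xz := nrm_Hbar12_Aform (U s - Un N s); rewrite -/q in xz.
  have y0 := nrm_Hbar_ge0 ip (Ut s - Utn N s).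
  have z0 := sqrtr_ge0 (Af (U s - Un N s) (U s - Un N s)).
  move: h h' xz y0 z0.
  set x := nrm X12 _; set y := nrm X0 _; set z := Num.sqrt _ => h h' xz y0 z0.
  have := mulr_ge0 y0 q0; lra.
have {}h1 := h1 _ (dUn N b bab) (le_trans (hN b bab) _).
have {}h2 := h2 _ (dUn N b bab) (le_trans (hN b bab) _).
have {}h3 := h3 _ (dUn N a aab) (le_trans (hN a aab) _).
have {}h1 := le_trans (ler_norm _) (h1 _).
have {}h2 := le_trans (ler_norm _) (h2 _).
rewrite distrC in h3; have {}h3 := le_trans (ler_norm _) (h3 _).
have hs := strong_dissipation (sol N) a0 ab bT.
have -> : r = tau * (2 + k * (b - a)) by rewrite /tau divfK// gt_eqF// ltr_wpDr.
have {}h2 : k * (b - a) * (energy 0 (U b, Ut b) - energy 0 (Un N b, Utn N b)) <= k * (b - a) * tau.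
  by rewrite ler_wpM2l// h2// /d !ge_min lexx ?orbT.
have {}h1 : energy e (U b, Ut b) - energy e (Un N b, Utn N b) <= tau.
  by rewrite h1// /d !ge_min lexx ?orbT.
have {}h3 : energy e (Un N a, Utn N a) - energy e (U a, Ut a) <= tau.
  by rewrite h3// /d !ge_min lexx ?orbT.
lra.
Qed.

(** If E(t) > C2 + 1, then W(t) + k (t - a) <= W(a) <= M + 1 for some a in ]0, 1[ close to 0, which
    contradicts W(t) >= - C0 once k (t - 1) > M + 1 + C0. *)
Lemma generalized_energy_bound T (U Ut : R -> HH) U0 U1 M C0 t :
  generalized_solution ip S nu1 nu2 D K B kappa T U Ut U0 U1 ->
  (forall Y, carrier Xp Y -> - C0 <= energy e Y) ->
  energy e (U0, U1) <= M -> 1 < t -> t < T -> M + 1 + C0 < k * (t - 1) ->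
  energy 0 (U t, Ut t) <= C2 + 1.
Proof.
move=> sol low eM t1 tT kt.
have [[Uc _ Utc U00 U10] _] := sol.
have in0 : 0 \in `[0, T] by rewrite in_itv/= lexx/=; lra.
have in0t : t \in `[0, T] by rewrite in_itv/=; apply/andP; split; lra.
have [d d0 hd] := smooth_continuous sp (energy_smooth e)
  ((Uc 0 in0).1 : carrier Xp (U 0, Ut 0)) ltr01.
have d20 : 0 < d / 2 by rewrite divr_gt0.
have [d1 d10 hd1] := cont_on_eps Uc in0 d20.
have [d2 d2_0 hd2] := cont_on_eps Utc in0 d20.
pose a := Num.min 1 (Num.min d1 d2) / 2.
have a_gt0 : 0 < a by rewrite divr_gt0// !lt_min ltr01 d10.
have a2 : a < Num.min 1 (Num.min d1 d2).
  by rewrite /a ltr_pdivrMr// ltr_pMr ?ltr1n// !lt_min ltr01 d10.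
move: a2; rewrite !lt_min => /andP[a1 /andP[ad1 ad2]].
have a_in : a \in `[0, T] by rewrite in_itv/=; apply/andP; split; lra.
have ea : energy e (U a, Ut a) <= M + 1.
  have na : nrm Xp ((U 0, Ut 0) - (U a, Ut a)) <= d.
    rewrite (sn_distC sp); [|exact: (Uc 0 in0).1|exact: (Uc a a_in).1].
    rewrite (le_trans (nrm_phase_le _ _ _))// [leRHS]splitr.
    by apply: lerD; [apply: hd1|apply: hd2] => //; rewrite subr0 gtr0_norm.
  have := hd _ ((Uc a a_in).1 : carrier Xp (U a, Ut a)) na.
  rewrite distrC U00 U10 => /(le_trans (ler_norm _)); lra.
have dis := generalized_dissipation sol a_gt0 (lt_trans a1 t1) tT.
have lowt := low (U t, Ut t) (Uc t in0t).1.
rewrite leNgt; apply/negP => big.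
have h1 : k * (t - 1) <= k * (t - a) by rewrite ler_wpM2l// lerD2l lerN2 ltW.
have h2 : k * (t - a) * 1 <= k * (t - a) * (energy 0 (U t, Ut t) - C2).
  rewrite ler_wpM2l ?mulr_ge0 ?subr_ge0// ?ltW ?(lt_trans a1)//; lra.
lra.
Qed.

Lemma generated_energy_bound (St : R -> HH * HH -> HH * HH) C0 M :
  0 < k -> (forall Y, carrier Xp Y -> - C0 <= energy e Y) ->
  generated_by ip S nu1 nu2 D K B kappa St ->
  exists2 t0 : R, 0 <= t0 & forall t Y, t0 <= t -> carrier Xp Y -> nrm Xp Y <= M ->
    carrier Xp (St t Y) /\ energy 0 (St t Y) <= C2 + 1.
Proof.
move=> k0 low gen.
have [L L0 hL] := smooth_lipschitz sp `|M| (energy_smooth e).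
(* A bound for W on the ball of initial data; it may depend on alpha and kappa, since only [t0] is
   built from it. *)
pose M1 := `|energy e 0| + L * `|M|.
have M10 : 0 <= M1 by rewrite addr_ge0// mulr_ge0.
pose q := (M1 + 1 + `|C0|) / k.
have q0 : 0 <= q by rewrite divr_ge0 ?(ltW k0)// addr_ge0// addr_ge0.
exists (2 + q) => [|t [U0 U1] tq dY YM]; first by rewrite addr_ge0.
have [t0 t1 tT] : [/\ 0 <= t, 1 < t & t < t + 1] by split; lra.
have sol := gen U0 U1 dY _ (le_lt_trans t0 tT).
have YM' := le_trans YM (ler_norm M).
have eM : energy e (U0, U1) <= M1.
  have := hL _ _ dY (sn0 sp) YM'; rewrite (sn_n0 sp) subr0 => /(_ (normr_ge0 _)).
  move=> /(le_trans (ler_norm _)); rewrite lerBlDl => /le_trans; apply.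
  by apply: lerD; [exact: ler_norm|exact: ler_wpM2l].
split.
  have [[Uc _ _ _ _] _] := sol.
  by apply: (Uc t _).1; rewrite /= in_itv/= t0 ltW.
rewrite [St t _]surjective_pairing.
apply: (generalized_energy_bound sol low eM t1 tT).
rewrite mulrC -ltr_pdivrMr//; apply: (@le_lt_trans _ _ q); last by lra.
by rewrite ler_wpM2r ?invr_ge0 ?(ltW k0)// lerD2l ler_norm.
Qed.

End Dissipation.
End Energy.

(** * Uniform dissipativity *)

Lemma matop_linear (R : realType) (H : completeNormedModType R) (S : pop H)
    (K : 'I_2 -> 'I_2 -> H -> H) :
  (forall i j, linear_on (carrier (H12 S)) (K i j)) ->
  linear_on (carrier (Hbar12 S)) (matop K).
Proof.
move=> KL a U W [U1 U2] [W1 W2]; rewrite /matop /= !KL//.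
by congr (_, _); rewrite /= scalerDr addrACA.
Qed.

Lemma diag_potential_smooth (R : realType) (H : completeNormedModType R)
    (ip : {dot H for idfun}) (ip_norm : forall x, ip x x = `|x| ^+ 2)
    (S : pop H) (saS : self_adjoint ip S) (c : R) (c_gt0 : 0 < c)
    (S_low : forall u, pdom S u -> `|u| <= c * `|S u|)
    (B : 'I_2 -> H -> H) (P : 'I_2 -> H -> R) :
  (forall i, locally_lipschitz_op S (B i)) ->
  (forall i, is_potential ip S (B i) (P i)) ->
  smooth (Hbar12 S) (sumfun P) (fun U W => ipb ip (diagop B U) W).
Proof.
move=> Blip Bpot.
have sm i := potential_smooth ip_norm saS c_gt0 S_low (Blip i) (Bpot i).
have fst_lin : linear_on (carrier (Hbar12 S)) (fst : H * H -> H) by [].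
have snd_lin : linear_on (carrier (Hbar12 S)) (snd : H * H -> H) by [].
have fst_le U : carrier (Hbar12 S) U ->
    carrier (H12 S) U.1 /\ nrm (H12 S) U.1 <= nrm (Hbar12 S) U.
  by move=> [dU _]; split=> //; exact: (nrm_H12_1 ip_norm).
have snd_le U : carrier (Hbar12 S) U ->
    carrier (H12 S) U.2 /\ nrm (H12 S) U.2 <= nrm (Hbar12 S) U.
  by move=> [_ dU]; split=> //; exact: (nrm_H12_2 ip_norm).
exact: smoothD (smooth_comp fst_lin fst_le (sm 0)) (smooth_comp snd_lin snd_le (sm 1)).
Qed.

Lemma closed_absorbing (R : realType) (V : lmodType R) (X : nspace V)
    (St : R -> V -> V) (B : set V) :
  closed_in X B ->
  (forall M : R, exists2 t0 : R, 0 <= t0 & forall t Y, t0 <= t -> carrier X Y ->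
     nrm X Y <= M -> B (St t Y)) ->
  absorbing X St B.
Proof.
move=> cB hB; split=> // D [DX [M DM]].
have [t0 t00 h] := hB M; exists t0 => // t tt0 _ [Y DY <-].
by apply: h => //; [exact: DX|exact: DM].
Qed.

(* Here v, a, k, d, b stand for |V|^2, (calA U, U), kappa (K U, U), (D V, V) and
   (B U, U), and p0, p for the values of Pi_0 and Pi at U. *)
Lemma dissipation_estimate (R : realFieldType)
    (eps c0 c1 eta delta C C1 v a k b d p0 p : R) :
  0 < eps -> eps <= c0 / 2 ->
  0 < c1 -> c1 <= 1 -> c1 <= 1 - eta -> c1 <= delta / 2 ->
  0 <= v -> 0 <= a -> 0 <= k -> 0 <= p0 ->
  p - p0 <= 4^-1 * a + 2^-1 * p0 + C1 ->
  c0 * v <= d -> delta * p0 - b <= eta * a + C ->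
  - d + eps * (v - a - k - b) <=
    - (eps * c1 * ((v + a + k) / 2 + p - (C1 + C / c1))).
Proof.
move=> eps0 eps_c0 c10 c1_1 c1_eta c1_delta v0 a0 k0 p00 hp hd hb.
have epsv : eps * v <= c0 / 2 * v by rewrite ler_wpM2r.
have c1e : c1 * ((v + a + k) / 2 + p - C1) <= v + (1 - eta) * a + k + delta * p0.
  have : c1 * ((v + a + k) / 2 + p - C1) <= c1 * (v + a + k + 2 * p0).
    by rewrite ler_pM2l//; lra.
  have : c1 * v <= 1 * v by rewrite ler_wpM2r.
  have : c1 * a <= (1 - eta) * a by rewrite ler_wpM2r.
  have : c1 * k <= 1 * k by rewrite ler_wpM2r.
  have : c1 * p0 <= delta / 2 * p0 by rewrite ler_wpM2r.
  lra.
have shift : c1 * ((v + a + k) / 2 + p - C1) - C =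
    c1 * ((v + a + k) / 2 + p - (C1 + C / c1)).
  by field; rewrite gt_eqF.
have : v - a - k - b <= 2 * v - c1 * ((v + a + k) / 2 + p - (C1 + C / c1)).
  by rewrite -shift; lra.
move=> /(ler_wpM2l (ltW eps0)); lra.
Qed.

(* Here u, w, v, a, z stand for |U|, |A^{1/2} U|, |V|, (calA U, U) and (U, V). *)
Lemma cross_term_estimate (R : realFieldType) (eps numin c u v w a z : R) :
  0 < eps -> eps <= 2^-1 -> eps <= numin / (2 * c ^+ 2) -> 0 < c ->
  0 <= u -> u <= c * w -> numin * w ^+ 2 <= a -> `|z| <= u * v ->
  - (v ^+ 2 / 4 + a / 4) <= eps * z.
Proof.
move=> eps0 eps_half eps_nu c_gt0 u0 uw wa zuv.
have c2 : 0 < 2 * c ^+ 2 by rewrite mulr_gt0// exprn_gt0.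
have uu : u ^+ 2 <= c ^+ 2 * w ^+ 2.
  by rewrite -exprMn ler_pXn2r ?nnegrE// (le_trans u0).
have ua : eps * u ^+ 2 <= a / 2.
  rewrite (le_trans (ler_wpM2l (ltW eps0) uu))// mulrA.
  have : eps * c ^+ 2 <= numin / 2 by move: eps_nu; rewrite ler_pdivlMr//; lra.
  by move=> /(ler_wpM2r (sqr_ge0 w)); lra.
have vv : eps * v ^+ 2 <= 2^-1 * v ^+ 2 by rewrite ler_wpM2r// sqr_ge0.
have : - z <= (u ^+ 2 + v ^+ 2) / 2.
  rewrite (le_trans (ler_norm _))// normrN (le_trans zuv)//.
  by have := sqr_ge0 (u - v); rewrite sqrrB; lra.
move=> /(ler_wpM2l (ltW eps0)); lra.
Qed.

Theorem theorem3p5 (R : realType) (H : completeNormedModType R)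
    (ip : {dot H for idfun}) (ip_norm : forall x, ip x x = `|x| ^+ 2)
    (H_separable : separable H)
    (A : pop H) (A_sa : self_adjoint ip A) (A_pos : positive_op ip A)
    (A_res : compact_resolvent A)
    (sqrtA : pop H) (sqrtA_def : is_sqrt_op ip A sqrtA)
    (nu1 nu2 : R) (nu1_gt0 : 0 < nu1) (nu2_gt0 : 0 < nu2)
    (K : 'I_2 -> 'I_2 -> H -> H)
    (K_linear : forall i j, linear_on (carrier (H12 sqrtA)) (K i j))
    (K_form : sym_nonneg ip sqrtA (matop K))
    (B : 'I_2 -> H -> H) (Pi0 Pi1 : 'I_2 -> H -> R)
    (B_lip : forall i, locally_lipschitz_op sqrtA (B i))
    (B_pot : forall i,
       is_potential ip sqrtA (B i) (fun u => Pi0 i u + Pi1 i u))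
    (Pi_adm : forall i, admissible_potential sqrtA (Pi0 i) (Pi1 i))
    (D0 : H * H -> H * H) (c0 abar : R)
    (D0_linear : linear_on (carrier (Hbar12 sqrtA)) D0)
    (D_form : forall alpha, abar <= alpha ->
       sym_nonneg ip sqrtA (fun W => D0 W + alpha *: matop K W))
    (D0_bounded : bounded_op ip sqrtA D0)
    (c0_gt0 : 0 < c0) (abar_ge0 : 0 <= abar)
    (D_coercive : forall W, carrier (Hbar12 sqrtA) W ->
       c0 * nrm (Hbar ip) W ^+ 2 <= ipb ip (D0 W + abar *: matop K W) W)
    (B_dissip : exists eta delta C : R, [/\ eta < 1, 0 < delta, 0 < C &
       forall U, carrier (Hbar12 sqrtA) U ->
         delta * sumfun Pi0 U - ipb ip (diagop B U) U
           <= eta * Aform ip sqrtA nu1 nu2 U U + C]) :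
  exists2 r : R, 0 < r &
    forall alpha kappa : R, abar <= alpha -> 0 <= kappa ->
    forall St : R -> (H * H) * (H * H) -> (H * H) * (H * H),
      generated_by ip sqrtA nu1 nu2 (fun W => D0 W + alpha *: matop K W)
        (matop K) (diagop B) kappa St ->
      [/\ dissipative (phase ip sqrtA) St,
          absorbing (phase ip sqrtA) St (ball_of (phase ip sqrtA) r) &
          absorbing (phase ip sqrtA) St
            (frakB ip sqrtA nu1 nu2 (matop K) kappa r)].
Proof.
have saS : self_adjoint ip sqrtA by case: sqrtA_def.
have [c c_gt0 S_low] := sqrt_op_lower_bound ip_norm A_sa A_res sqrtA_def.
have [_ SL _ _ _] := saS.
have s0 := seminormed_Hbar ip_norm.
have s12 := seminormed_Hbar12 ip_norm saS.
have sp := seminormed_phase ip_norm saS.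
have KL := matop_linear K_linear.
have P_smooth := diag_potential_smooth ip_norm saS c_gt0 S_low B_lip B_pot.
set P := sumfun _ in P_smooth.
set Af := Aform ip sqrtA nu1 nu2 in B_dissip *.
pose numin := Num.min nu1 nu2.
have numin_gt0 : 0 < numin by rewrite lt_min nu1_gt0.
have [eta [delta [C [eta1 delta0 Cgt0 dissB]]]] := B_dissip.
have AfE U : numin * (`|sqrtA U.1| ^+ 2 + `|sqrtA U.2| ^+ 2) <= Af U U.
  rewrite mulrDr /Af /Aform !ip_norm.
  by apply: lerD; rewrite ler_wpM2r ?sqr_ge0// ge_min lexx ?orbT.
have Af_ge0 U : 0 <= Af U U.
  by rewrite (le_trans _ (AfE U))// mulr_ge0 ?(ltW numin_gt0)// addr_ge0 ?sqr_ge0.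
(* Turns the smallness of Pi_1 into |Pi_1| <= (calA U, U) / 4 + Pi_0 / 2 + C1, which leaves part of
   each positive term of E. *)
pose eta2 := Num.min 2^-1 (numin / 4).
have eta2_gt0 : 0 < eta2 by rewrite lt_min invr_gt0 ltr0n divr_gt0.
have [C1 [C1_ge0 hP]] : exists C1, 0 <= C1 /\ forall U, carrier (Hbar12 sqrtA) U ->
    0 <= sumfun Pi0 U /\
    `|P U - sumfun Pi0 U| <= 4^-1 * Af U U + 2^-1 * sumfun Pi0 U + C1.
  have [Pi00_ge0 _ /(_ _ eta2_gt0) [Ca ha]] := Pi_adm 0.
  have [Pi01_ge0 _ /(_ _ eta2_gt0) [Cb hb]] := Pi_adm 1.
  exists (`|Ca| + `|Cb|); split; first exact: addr_ge0.
  move=> U [dU1 dU2]; have p0 := Pi00_ge0 _ dU1; have p1 := Pi01_ge0 _ dU2.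
  split; first exact: addr_ge0.
  have {}ha := ha _ dU1; have {}hb := hb _ dU2.
  rewrite /P /sumfun (_ : _ - _ = Pi1 0 U.1 + Pi1 1 U.2); last by ring.
  have e1 : eta2 <= 2^-1 by rewrite ge_min lexx.
  have e2 : eta2 <= numin / 4 by rewrite ge_min lexx orbT.
  have h1 : eta2 * (Pi0 0 U.1 + Pi0 1 U.2) <= 2^-1 * (Pi0 0 U.1 + Pi0 1 U.2).
    by rewrite ler_wpM2r// addr_ge0.
  have h2 : eta2 * (`|sqrtA U.1| ^+ 2 + `|sqrtA U.2| ^+ 2) <=
      numin / 4 * (`|sqrtA U.1| ^+ 2 + `|sqrtA U.2| ^+ 2).
    by rewrite ler_wpM2r// addr_ge0 ?sqr_ge0.
  have h3 := AfE U; have h4 := ler_norm Ca; have h5 := ler_norm Cb.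
  rewrite (le_trans (ler_normD _ _))//; lra.
(* The rate at which c1 E stays below what is available: coefficient 1 for |V|^2 and kappa (K U, U),
   1 - eta for (calA U, U), and delta for Pi_0, which enters the bound of E with factor 2 after
   doubling. *)
pose c1 := Num.min 1 (Num.min (1 - eta) (delta / 2)).
have c1_gt0 : 0 < c1 by rewrite !lt_min ltr01 subr_gt0 eta1 divr_gt0.
have [c1_1 [c1_eta c1_delta]] : c1 <= 1 /\ c1 <= 1 - eta /\ c1 <= delta / 2.
  by rewrite /c1 !ge_min !lexx ?orbT.
(* The first bound is for absorption by the damping, the other two for the cross term (U, V). *)
pose eps := Num.min (c0 / 2) (Num.min 2^-1 (numin / (2 * c ^+ 2))).
have eps_gt0 : 0 < eps.
  by rewrite !lt_min invr_gt0 ltr0n !divr_gt0// mulr_gt0// exprn_gt0.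
have [eps_c0 [eps_half eps_nu]] : eps <= c0 / 2 /\ eps <= 2^-1 /\ eps <= numin / (2 * c ^+ 2).
  by rewrite /eps !ge_min !lexx ?orbT.
pose C2 := C1 + C / c1.
(* By [E_low] below, E + C1 dominates a quarter of the quadratic terms, and the final level of E is
   C2 + 1. *)
pose r1 := 4 * (C2 + 1 + C1).
have C2_ge0 : 0 <= C2 by rewrite addr_ge0// divr_ge0// ltW.
have r1_gt0 : 0 < r1 by rewrite mulr_gt0// ltr_wpDr// ltr_wpDl.
(* The factor 1 + 1/numin passes from (calA U, U) to the phase norm; r >= 1 gives r <= r^2, so that
   one radius serves both sets. *)
pose r := 1 + r1 * (1 + numin^-1).
have r_ge1 : 1 <= r by rewrite /r lerDl mulr_ge0 ?ltW// addr_gt0// invr_gt0.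
exists r; first exact: lt_le_trans ltr01 r_ge1.
(* Only now are alpha and kappa fixed: all constants above are independent of them. *)
move=> alpha kappa ab_al kappa0 St gen.
set D := fun W => D0 W + alpha *: matop K W in gen.
have D_nonneg : sym_nonneg ip sqrtA D by exact: D_form.
have DL : linear_on (carrier (Hbar12 sqrtA)) D.
  move=> a U W dU dW; rewrite /D D0_linear// KL// !scalerDr !scalerA (mulrC alpha).
  by rewrite addrACA.
have D_coer V : carrier (Hbar12 sqrtA) V -> c0 * nrm (Hbar ip) V ^+ 2 <= ipb ip (D V) V.
  move=> dV; rewrite (le_trans (D_coercive V dV))// /D !ipbDl !ipbZl lerD2l.
  by rewrite ler_wpM2r//; exact: K_form.2.
pose E := energy ip sqrtA nu1 nu2 D (matop K) P kappa.
have E0E U V : E 0 (U, V) = (nrm (Hbar ip) V ^+ 2 + Af U U +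
    kappa * ipb ip (matop K U) U) / 2 + P U.
  by rewrite -(ipb_nrm ip_norm) /E /energy /energy_form mul0r addr0.
have K_nonneg U : carrier (Hbar12 sqrtA) U -> 0 <= kappa * ipb ip (matop K U) U.
  by move=> dU; rewrite mulr_ge0//; exact: K_form.2.
have E_low U V : carrier (Hbar12 sqrtA) U ->
    nrm (Hbar ip) V ^+ 2 / 2 + Af U U / 4 + kappa * ipb ip (matop K U) U / 2 - C1
      <= E 0 (U, V).
  move=> dU; have [p0] := hP U dU; rewrite E0E ler_norml => /andP[+ _].
  move: p0; clear; lra.
have dissip U V : carrier (Hbar12 sqrtA) U -> carrier (Hbar12 sqrtA) V ->
     - ipb ip (D V) V + eps * (ipb ip V V - Af U U - kappa * ipb ip (matop K U) U
       - ipb ip (diagop B U) U) <= - ((eps * c1) * (E 0 (U, V) - C2)).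
  move=> dU dV; have [p0 hPU] := hP U dU.
  rewrite (ipb_nrm ip_norm) E0E.
  apply: (dissipation_estimate eps_gt0 eps_c0 c1_gt0 c1_1 c1_eta c1_delta
    (sqr_ge0 _) (Af_ge0 U) (K_nonneg U dU) p0 (le_trans (ler_norm _) hPU)
    (D_coer V dV) (dissB U dU)).
(* The cross term costs at most |V|^2 / 4 + (calA U, U) / 4, which [E_low] can afford, and (D U, U)
   >= 0 is dropped; hence the bound does not see alpha. *)
have E_eps_low Y : carrier (phase ip sqrtA) Y -> - C1 <= E eps Y.
  case: Y => U V dU.
  have d0 : 0 <= eps * ipb ip (D U) U.
    by rewrite mulr_ge0 ?(ltW eps_gt0)//; exact: D_nonneg.2.
  have -> : E eps (U, V) = E 0 (U, V) + eps * ipb ip U V + eps * ipb ip (D U) U / 2.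
    by rewrite /E /energy /energy_form /= mul0r addr0 (ipbC ip V U); field.
  have wa : numin * nrm (Hbar12 sqrtA) U ^+ 2 <= Af U U.
    by rewrite (nrm_Hbar12_sqr ip_norm).
  move: (E_low U V dU) (K_nonneg U dU) d0 (sqr_ge0 (nrm (Hbar ip) V))
    (cross_term_estimate eps_gt0 eps_half eps_nu c_gt0 (nrm_Hbar_ge0 ip U)
      (nrm_Hbar_le ip_norm c_gt0 S_low dU) wa (ipb_CS ip_norm U V)).
  clear; lra.
have ultimately M := generated_energy_bound ip_norm saS c_gt0 S_low nu1_gt0 nu2_gt0 DL KL
  D_nonneg K_form P_smooth (ltW (mulr_gt0 eps_gt0 c1_gt0)) dissip M
  (mulr_gt0 eps_gt0 c1_gt0) E_eps_low gen.
have r_sqr : r <= r ^+ 2 by rewrite expr2 ler_peMr// (le_trans ler01).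
have r1r : r1 <= r.
  by move: (divr_gt0 r1_gt0 numin_gt0); rewrite /r; clear; lra.
have E_bound U V : carrier (Hbar12 sqrtA) U -> E 0 (U, V) <= C2 + 1 ->
    nrm (Hbar ip) V ^+ 2 + Af U U + kappa * ipb ip (matop K U) U <= r1.
  move=> dU; move: (E_low U V dU) (K_nonneg U dU) (sqr_ge0 (nrm (Hbar ip) V)).
  move: (Af_ge0 U); rewrite /r1; clear; lra.
have absB : absorbing (phase ip sqrtA) St (frakB ip sqrtA nu1 nu2 (matop K) kappa r).
  apply: closed_absorbing.
    (* The set is a sublevel set of the quadratic part of E, which is continuous on the phase
       space. *)
    have := closed_in_sublevel (r ^+ 2 / 2) (smooth_continuous sp
      (energy_form_smooth ip_norm saS c_gt0 S_low nu1_gt0 nu2_gt0 kappa DL KL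
        D_nonneg K_form 0)).
    congr (closed_in _ _); apply/seteqP; split=> -[U V] [dU h]; split=> //; move: h;
      by rewrite /energy_form mul0r addr0 ler_pM2r ?invr_gt0// (ipb_nrm ip_norm).
  move=> M; have [t0 t00 h] := ultimately M; exists t0 => // t Y tt0 dY YM.
  have [] := h t Y tt0 dY YM; case: (St t Y) => U V dU EU; split=> //.
  exact: le_trans (E_bound U V dU EU) (le_trans r1r r_sqr).
have absX : absorbing (phase ip sqrtA) St (ball_of (phase ip sqrtA) r).
  apply: closed_absorbing.
    exact: closed_in_ball.
  move=> M; have [t0 t00 h] := ultimately M; exists t0 => // t Y tt0 dY YM.
  have [] := h t Y tt0 dY YM; case: (St t Y) => U V dU EU; split=> //.
  have r_ge0 : 0 <= r := le_trans ler01 r_ge1.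
  rewrite -(@ler_pXn2r _ 2)// ?nnegrE ?nrm_phase_ge0// (le_trans _ r_sqr)//.
  rewrite nrm_phase_sqr [(U, V).1]/= [(U, V).2]/= (nrm_Hbar12_sqr ip_norm).
  have v0 := sqr_ge0 (nrm (Hbar ip) V); have a0 := Af_ge0 U.
  have hr := E_bound U V dU EU; have k0 := K_nonneg U dU.
  have h1 := AfE U; rewrite -ler_pdivlMl// in h1.
  have h2 : numin^-1 * Af U U <= numin^-1 * r1.
    by rewrite ler_pM2l ?invr_gt0//; move: v0 a0 hr k0; clear; lra.
  by move: v0 a0 hr k0 h1 h2; rewrite /r; clear; lra.
split=> //; exists (ball_of (phase ip sqrtA) r) => //.
by split; [move=> Y []|exists r => Y []].
Qed.
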